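(* Let $m,n$ be non-zero integers with $0<m\leq |n|$, let $G=\mathrm{BS}(m,n)=\langle a,t\mid t^{-1}a^{m}t=a^{n}\rangle$, let $d=\gcd(m,n)\geq 1$, and write $m=dm_1$, $n=dn_1$. (1) If $n_1\not\equiv m_1 \pmod p$ for every prime number $p$, then $\gamma_{\omega}(G)$ is the normal closure in $G$ of the set $\{a^{d}\}\cup\{[t^{-k}a^{\mu}t^{k},a^{\nu}] \mid k\in\mathbb{Z},\ \mu,\nu\in\mathbb{N},\ \gcd(\mu,\nu)=1,\ \mu\nu=d\}$. (2) If there is a prime number $p$ such that $n_1\equiv m_1\pmod p$, then $\gamma_{\omega}(G)$ is the normal closure in $G$ of the set $\{[t^{-k}a^{\mu}t^{k},a^{\nu}] \mid k\in\mathbb{Z},\ \mu,\nu\in\mathbb{N},\ \gcd(\mu,\nu)=1,\ \mu\nu=d\}$.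
   Context: For a group $G$, $[x,y]=x^{-1}y^{-1}xy$; $\gamma_1(G)=G$, $\gamma_{c}(G)=[\gamma_{c-1}(G),G]$ for $c\ge 2$ are the terms of the lower central series, and $\gamma_{\omega}(G)=\bigcap_{c\geq 1}\gamma_c(G)$. $\mathbb{N}$ denotes the positive integers. *)

(* Defs.v *)
From HB Require Import structures.
From mathcomp Require Import all_boot generic_quotient all_order ssralg ssrnum ssrint intdiv.
From mathcomp Require Import boolp classical_sets.

Set Implicit Arguments.
Unset Strict Implicit.
Unset Printing Implicit Defensive.

Local Open Scope classical_set_scope.
Local Open Scope quotient_scope.
Local Open Scope group_scope.

Definition expgz (G : groupType) (x : G) (k : int) : G :=
  match k with Posz n => x ^+ n | Negz n => x ^- n.+1 end.

Definition is_subgroup (G : groupType) (H : set G) : Prop :=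
  [/\ H 1,
      (forall x y, H x -> H y -> H (x * y)) &
      (forall x, H x -> H x^-1)].

Definition is_normal_subgroup (G : groupType) (H : set G) : Prop :=
  is_subgroup H /\ (forall x y, H x -> H (x ^ y)).

Definition subgroup_generated (G : groupType) (S : set G) : set G :=
  smallest (@is_subgroup G) S.

Definition normal_closure (G : groupType) (S : set G) : set G :=
  smallest (@is_normal_subgroup G) S.

Definition commutator_subgroup (G : groupType) (H K : set G) : set G :=
  subgroup_generated [set [~ x, y] | x in H & y in K].

(* The terms are numbered from gamma 1 = G; the index 0 is not meant to be
   used (gamma 0 is also the whole group). *)
Definition gamma (G : groupType) (c : nat) : set G :=
  iter c.-1 (fun H : set G => commutator_subgroup H setT) setT.

Definition gamma_omega (G : groupType) : set G :=
  \bigcap_(c in [set c | (1 <= c)%N]) gamma c.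

Arguments gamma : clear implicits.
Arguments gamma_omega : clear implicits.

(* Group words over X: the letter (x, false) stands for x and the letter
   (x, true) for x^-1. *)
Definition word (X : Type) := seq (X * bool).

Definition word_inv (X : Type) (w : word X) : word X :=
  rev [seq (l.1, ~~ l.2) | l <- w].

Definition word_exp (X : Type) (x : X) (k : int) : word X :=
  nseq `|k|%N (x, (k < 0)%R).

(* A presentation is given by a set R of pairs (l, r), read as the defining
   relations l = r; pres_eq R is the least congruence on words that identifies
   the two sides of each relation and makes x and x^-1 inverse to each other. *)
Inductive pres_eq (X : Type) (R : set (word X * word X)) :
    word X -> word X -> Prop :=
| pres_eq_refl u : pres_eq R u u
| pres_eq_sym u v : pres_eq R u v -> pres_eq R v u
| pres_eq_trans u v w : pres_eq R u v -> pres_eq R v w -> pres_eq R u w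
| pres_eq_cancel u v x b : pres_eq R (u ++ [:: (x, b); (x, ~~ b)] ++ v) (u ++ v)
| pres_eq_rel u v l r : R (l, r) -> pres_eq R (u ++ l ++ v) (u ++ r ++ v).

Lemma pres_eq_cat (X : Type) (R : set (word X * word X)) u u' v v' :
  pres_eq R u u' -> pres_eq R v v' -> pres_eq R (u ++ v) (u' ++ v').
Proof.
move=> uu' vv'; apply: (@pres_eq_trans _ _ _ (u' ++ v)).
  elim: uu' => [w|w w' _|w1 w2 w3 _ IH1 _|w w' x b|w w' l r Rlr].
  - exact: pres_eq_refl.
  - exact: pres_eq_sym.
  - exact: pres_eq_trans IH1.
  - by rewrite -!catA; apply: pres_eq_cancel.
  - by rewrite -!catA; apply: pres_eq_rel.
elim: vv' => [w|w w' _|w1 w2 w3 _ IH1 _|w w' x b|w w' l r Rlr].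
- exact: pres_eq_refl.
- exact: pres_eq_sym.
- exact: pres_eq_trans IH1.
- by rewrite !(catA u'); apply: pres_eq_cancel.
- by rewrite !(catA u'); apply: pres_eq_rel.
Qed.

Lemma word_invK (X : Type) : involutive (@word_inv X).
Proof.
move=> w; rewrite /word_inv map_rev revK -map_comp -[RHS]map_id.
by apply: eq_map => -[x b] /=; rewrite negbK.
Qed.

Lemma pres_eq_invr (X : Type) (R : set (word X * word X)) w :
  pres_eq R (w ++ word_inv w) [::].
Proof.
elim: w => [|[x b] w IH]; first exact: pres_eq_refl.
rewrite /word_inv /= rev_cons -cats1 catA -cat1s.
apply: (@pres_eq_trans _ _ _ ([:: (x, b)] ++ [::] ++ [:: (x, ~~ b)])).
  apply: pres_eq_cat; first exact: pres_eq_refl.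
  by apply: pres_eq_cat => //; apply: pres_eq_refl.
exact: (@pres_eq_cancel _ R [::] [::]).
Qed.

Lemma pres_eq_invl (X : Type) (R : set (word X * word X)) w :
  pres_eq R (word_inv w ++ w) [::].
Proof. by have := pres_eq_invr R (word_inv w); rewrite word_invK. Qed.

Lemma pres_eq_inv (X : Type) (R : set (word X * word X)) u v :
  pres_eq R u v -> pres_eq R (word_inv u) (word_inv v).
Proof.
move=> uv; apply: (@pres_eq_trans _ _ _ (word_inv u ++ v ++ word_inv v)).
  rewrite -[X in pres_eq _ X]cats0; apply: pres_eq_cat.
    exact: pres_eq_refl.
  exact/pres_eq_sym/pres_eq_invr.
rewrite catA -[X in pres_eq _ _ X]cat0s; apply: pres_eq_cat.
  apply: (@pres_eq_trans _ _ _ (word_inv u ++ u)); last exact: pres_eq_invl.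
  by apply: pres_eq_cat; [exact: pres_eq_refl|exact: pres_eq_sym].
exact: pres_eq_refl.
Qed.

Definition pres_rel (X : choiceType) (R : set (word X * word X)) :
  rel (word X) := fun u v => `[< pres_eq R u v >].

Lemma pres_relP (X : choiceType) (R : set (word X * word X)) :
  equiv_class_of (pres_rel R).
Proof.
split=> [u|u v|v u w].
- by apply/asboolP/pres_eq_refl.
- by apply/asboolP/asboolP => /pres_eq_sym.
- by move=> /asboolP uv /asboolP vw; apply/asboolP/(pres_eq_trans uv vw).
Qed.

Canonical pres_equiv (X : choiceType) (R : set (word X * word X)) :=
  EquivRelPack (pres_relP R).

Definition presented (X : choiceType) (R : set (word X * word X)) : Type :=
  {eq_quot (pres_equiv R)}.

HB.instance Definition _ (X : choiceType) (R : set (word X * word X)) :=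
  Choice.copy (presented R) {eq_quot (pres_equiv R)}.

Definition pres_pi (X : choiceType) (R : set (word X * word X)) (w : word X) :
  presented R := (\pi_{eq_quot (pres_equiv R)} w)%qT.

Definition pres_repr (X : choiceType) (R : set (word X * word X))
  (x : presented R) : word X := repr (x : {eq_quot (pres_equiv R)}).

Definition pres_mul (X : choiceType) (R : set (word X * word X))
  (x y : presented R) : presented R := pres_pi R (pres_repr x ++ pres_repr y).

Definition pres_inv (X : choiceType) (R : set (word X * word X))
  (x : presented R) : presented R := pres_pi R (word_inv (pres_repr x)).

Lemma pres_piP (X : choiceType) (R : set (word X * word X)) u v :
  pres_pi R u = pres_pi R v <-> pres_eq R u v.
Proof.
split=> [/eqquotP/asboolP //|uv].
by apply/eqquotP/asboolP.
Qed.

Lemma pres_reprK (X : choiceType) (R : set (word X * word X)) :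
  cancel (@pres_repr X R) (pres_pi R).
Proof. by move=> x; apply: reprK. Qed.

Lemma pres_mulE (X : choiceType) (R : set (word X * word X)) u v :
  pres_mul (pres_pi R u) (pres_pi R v) = pres_pi R (u ++ v).
Proof. by apply/pres_piP/pres_eq_cat; apply/pres_piP/pres_reprK. Qed.

Lemma pres_invE (X : choiceType) (R : set (word X * word X)) u :
  pres_inv (pres_pi R u) = pres_pi R (word_inv u).
Proof. by apply/pres_piP/pres_eq_inv/pres_piP/pres_reprK. Qed.

Lemma pres_mulA (X : choiceType) (R : set (word X * word X)) :
  associative (@pres_mul X R).
Proof.
move=> x y z; rewrite -(pres_reprK x) -(pres_reprK y) -(pres_reprK z).
by rewrite !pres_mulE catA.
Qed.

Lemma pres_mul1 (X : choiceType) (R : set (word X * word X)) :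
  left_id (pres_pi R [::]) (@pres_mul X R).
Proof. by move=> x; rewrite -(pres_reprK x) pres_mulE. Qed.

Lemma pres_mulr1 (X : choiceType) (R : set (word X * word X)) :
  right_id (pres_pi R [::]) (@pres_mul X R).
Proof. by move=> x; rewrite -(pres_reprK x) pres_mulE cats0. Qed.

Lemma pres_mulV (X : choiceType) (R : set (word X * word X)) :
  left_inverse (pres_pi R [::]) (@pres_inv X R) (@pres_mul X R).
Proof.
move=> x; rewrite -(pres_reprK x) pres_invE pres_mulE.
exact/pres_piP/pres_eq_invl.
Qed.

Lemma pres_mulrV (X : choiceType) (R : set (word X * word X)) :
  right_inverse (pres_pi R [::]) (@pres_inv X R) (@pres_mul X R).
Proof.
move=> x; rewrite -(pres_reprK x) pres_invE pres_mulE.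
exact/pres_piP/pres_eq_invr.
Qed.

HB.instance Definition _ (X : choiceType) (R : set (word X * word X)) :=
  isGroup.Build (presented R) (@pres_mulA X R) (@pres_mul1 X R)
    (@pres_mulr1 X R) (@pres_mulV X R) (@pres_mulrV X R).

Definition pres_gen (X : choiceType) (R : set (word X * word X)) (x : X) :
  presented R := pres_pi R [:: (x, false)].

Inductive bs_letter : Set := letter_a | letter_t.

Definition bool_of_bs_letter x := if x is letter_t then true else false.
Definition bs_letter_of_bool b := if b then letter_t else letter_a.
Lemma bool_of_bs_letterK : cancel bool_of_bs_letter bs_letter_of_bool.
Proof. by case. Qed.

HB.instance Definition _ :=
  Choice.copy bs_letter (can_type bool_of_bs_letterK).

Definition BS_relations (m n : int) : set (word bs_letter * word bs_letter) :=
  [set (word_exp letter_t (- 1)%R ++ word_exp letter_a m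
          ++ word_exp letter_t 1%R,
        word_exp letter_a n)].

Definition BS (m n : int) : groupType := presented (BS_relations m n).

Definition BS_a (m n : int) : BS m n := pres_gen _ letter_a.
Definition BS_t (m n : int) : BS m n := pres_gen _ letter_t.

Definition BS_commutators (m n : int) (d : nat) : set (BS m n) :=
  [set g | exists (k : int) (mu nu : nat),
     [/\ (0 < mu)%N, (0 < nu)%N, gcdn mu nu = 1%N, (mu * nu)%N = d &
         g = [~ expgz (BS_t m n) (- k)%R * BS_a m n ^+ mu * expgz (BS_t m n) k,
                BS_a m n ^+ nu]]].
Arguments BS_commutators : clear implicits.

(* Main.v *)
From HB Require Import structures.
Require Import Defs.
From mathcomp Require Import all_boot generic_quotient all_order.
From mathcomp Require Import ssralg ssrnum ssrint intdiv zmodp matrix zify.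
From mathcomp Require Import boolp classical_sets.

(** Write a_k for t^-k a t^k, so that a_(k+1)^m = a_k^n, and let N be the
normal closure of the commutators [a_k^mu, a^nu] with mu, nu coprime and
mu nu = d.

Lower bound.  Suppose that C_k = [a_k^mu, a^nu] lies in the c-th term of the
lower central series for all k.  Modulo the next term these elements are
central, so the commutator is bilinear in powers of its entries, and moving
the relation a_(k+1)^m = a_k^n through the first or the second entry gives,
additively, nu (m1 C_(k+1) - n1 C_k) = 0 and mu (n1 C_(k+1) - m1 C_k) = 0.
As C_0 = 0, coprimality alone forces all the C_k to vanish
([central_commutators_trivial]), and N is contained in gamma_omega by
induction on c.  If no prime divides n1 - m1, then n1 - m1 is 1 or -1 and a^d
is the commutator of a^m and t or its inverse.  As a^m is a power of a^d, the
element a^d descends from each term to the next ([BS_power_gamma_omega]).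

Upper bound up to a^d.  For a power q of a prime p dividing d, killing a^q
turns G into the free product of Z/q and Z, which is residually nilpotent:
in characteristic p it has a Magnus embedding, a to 1 + A with A^q = 0, and
the coefficient of a reduced word in its own image is 1.  Hence gamma_omega
is contained in the normal closure of a^q ([gamma_omega_prime_power]).  The
commutators in N say that the primary parts of the a_k commute with each
other, so that modulo N and a^d the subgroup generated by the a_k is
recovered from its primary parts, and gamma_omega lies in the normal closure
of a^d and N ([gamma_omega_power_closure]).  This settles the first case.

Second case, where a prime p divides n1 - m1.  Modulo N the elements a_k^d
commute with every a_l, and since m1 and n1 are coprime any finitely many of
them lie in one cyclic group generated by a root of some a_s^d
([rational_chain_locally_cyclic]).  So a power of any g in gamma_omega is,
modulo N, conjugate to some a^(d r), which then lies in gamma_omega.  But G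
acts on Z/p^c by affine maps, a as the translation by 1 and t as the
multiplication by n1/m1, and this action has a nilpotent image because n1/m1
is 1 modulo p.  Therefore d r = 0 ([gamma_omega_power_trivial]), and this
brings g into N ([power_closure_gamma_omega]). *)

Set Implicit Arguments.
Unset Strict Implicit.
Unset Printing Implicit Defensive.

(** * Integer powers, quotients and the lower central series *)

Section IntegerPowers.
Local Open Scope group_scope.
Variable G : groupType.
Implicit Types (x y : G) (i j : int).

Lemma expgzDn x i (n : nat) : expgz x (i + n%:Z)%R = expgz x i * x ^+ n.
Proof.
elim: n => [|n IH]; first by rewrite GRing.addr0 expg0 mulg1.
rewrite expgSr mulgA -IH -addn1 PoszD GRing.addrA.
case: (i + n)%R => k /=; first by rewrite addn1 expgSr.
case: k => [|k] /=; first by rewrite expg1 mulVg.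
by rewrite subn1 /= [in RHS]expgS invgM mulgVK.
Qed.

Lemma expgzD x i j : expgz x (i + j)%R = expgz x i * expgz x j.
Proof.
case: j => n; first exact: expgzDn.
apply: (mulIg (x ^+ n.+1)); rewrite -expgzDn NegzE GRing.subrK /=.
by rewrite mulgVK.
Qed.

Lemma expgzN x i : expgz x (- i)%R = (expgz x i)^-1.
Proof.
by apply: (mulIg (expgz x i)); rewrite -expgzD GRing.addNr mulVg.
Qed.

Lemma expgzB x i j : expgz x (i - j)%R = expgz x i / expgz x j.
Proof. by rewrite expgzD expgzN. Qed.

Lemma commute_expgz x y i : commute x y -> commute (expgz x i) y.
Proof.
move=> cxy; apply: commute_sym; case: i => n /=.
  by apply: commuteX; apply: commute_sym.
by apply: commuteV; apply: commuteX; apply: commute_sym.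
Qed.

Lemma commute_expgz2 x y i j : commute x y -> commute (expgz x i) (expgz y j).
Proof.
by move=> cxy; apply/commute_expgz/commute_sym/commute_expgz/commute_sym.
Qed.

Lemma expgMz x y i : commute x y -> expgz (x * y) i = expgz x i * expgz y i.
Proof.
case: i => n cxy /=; first exact: expgMn.
rewrite expgMn // invgM.
by apply: commute_sym; apply: (@commute_expgz2 x y (Negz n) (Negz n)).
Qed.

Lemma expgz1 i : expgz (1 : G) i = 1.
Proof. by case: i => n /=; rewrite expg1n ?invg1. Qed.

Lemma expgVz x i : expgz x^-1 i = (expgz x i)^-1.
Proof. by case: i => n /=; rewrite expVgn. Qed.

Lemma expgzM x i j : expgz x (i * j)%R = expgz (expgz x i) j.
Proof.
have nat_case (n : nat) k : expgz x (k * n%:Z)%R = expgz x k ^+ n.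
  elim: n => [|n IH]; first by rewrite GRing.mulr0 expg0.
  by rewrite -addn1 PoszD GRing.mulrDr GRing.mulr1 expgzD IH addn1 expgSr.
case: j => n; first exact: nat_case.
by rewrite NegzE GRing.mulrN !expgzN nat_case.
Qed.

Lemma expgzAC x i j : expgz (expgz x i) j = expgz (expgz x j) i.
Proof. by rewrite -!expgzM GRing.mulrC. Qed.

Lemma conjXz x y i : (expgz x i) ^ y = expgz (x ^ y) i.
Proof. by case: i => n /=; rewrite ?conjVg conjXg. Qed.

Lemma expgz_coprime_eq1 x i j :
  coprimez i j -> expgz x i = 1 -> expgz x j = 1 -> x = 1.
Proof.
move=> /coprimezP[[u v] /= uv] xi xj.
have <- : expgz x 1%R = x by [].
by rewrite -uv expgzD (GRing.mulrC u) (GRing.mulrC v) !expgzM xi xj !expgz1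
           mulg1.
Qed.

Lemma commgXz x y i :
  commute [~ x, y] x -> [~ expgz x i, y] = expgz [~ x, y] i.
Proof.
move=> cx; rewrite commgEl conjXz.
have -> : x ^ y = x * [~ x, y] by rewrite commgEl mulVKg.
by rewrite expgMz ?mulKg //; exact: commute_sym.
Qed.

Lemma commgzX x y j :
  commute [~ x, y] y -> [~ x, expgz y j] = expgz [~ x, y] j.
Proof.
move=> cy; rewrite -invgR commgXz ?expgVz.
  by rewrite -expgVz invgR.
by rewrite -[[~ y, x]]invgR; apply: commute_sym; apply: commuteV;
  apply: commute_sym.
Qed.

End IntegerPowers.

Section Morphisms.
Local Open Scope group_scope.
Variables (G Q : groupType) (pi : G -> Q).
Hypothesis piM : {morph pi : x y / x * y}.

Lemma group_morphism :
  [/\ pi 1 = 1, {morph pi : x / x^-1}, {morph pi : x y / x ^ y},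
      {morph pi : x y / [~ x, y]} & forall n, {morph pi : x / x ^+ n}].
Proof.
have pi1 : pi 1 = 1 by apply: (@mulgI _ (pi 1)); rewrite -piM !mulg1.
have piV : {morph pi : x / x^-1}.
  by move=> x; apply: (@mulgI _ (pi x)); rewrite -piM !mulgV.
have piJ : {morph pi : x y / x ^ y} by move=> x y; rewrite !conjgE !piM piV.
split=> // [x y|n x]; first by rewrite !commgEl piM piJ piV.
by elim: n => [|n IH]; rewrite ?expg0 // !expgS piM IH.
Qed.

Lemma morph_expgz x i : pi (expgz x i) = expgz (pi x) i.
Proof.
have [_ piV _ _ piX] := group_morphism.
by case: i => k /=; rewrite ?piV piX.
Qed.

End Morphisms.

Section Subgroups.
Local Open Scope classical_set_scope.
Local Open Scope group_scope.
Variable G : groupType.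
Implicit Types (H N S : set G).

Lemma normal_closure_sub S : S `<=` normal_closure S.
Proof. exact: sub_smallest. Qed.

Lemma normal_closure_min S N :
  is_normal_subgroup N -> S `<=` N -> normal_closure S `<=` N.
Proof. exact: smallest_sub. Qed.

Lemma subgroup_generated_min S H :
  is_subgroup H -> S `<=` H -> subgroup_generated S `<=` H.
Proof. exact: smallest_sub. Qed.

Lemma subgroup_generated_sub S : S `<=` subgroup_generated S.
Proof. exact: sub_smallest. Qed.

Lemma subgroup_generated_subgroup S : is_subgroup (subgroup_generated S).
Proof.
split=> [|x y Sx Sy|x Sx] H [sgH SH]; have [H1 HM HV] := sgH => //.
  by apply: HM; [apply: Sx|apply: Sy].
by apply: HV; apply: Sx.
Qed.

Lemma normal_closure_normal S : is_normal_subgroup (normal_closure S).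
Proof.
split=> [|x y Sx N [sgN SN]]; last by apply: sgN.2; apply: Sx.
split=> [|x y Sx Sy|x Sx] N [sgN SN]; have [[N1 NM NV] _] := sgN => //.
  by apply: NM; [apply: Sx|apply: Sy].
by apply: NV; apply: Sx.
Qed.

Lemma subgroup_expgz H x i : is_subgroup H -> H x -> H (expgz x i).
Proof.
move=> [H1 HM HV] Hx.
have HX n : H (x ^+ n).
  by elim: n => [|n IH]; rewrite ?expg0 // expgS; apply: HM.
by case: i => n /=; [|apply: HV].
Qed.

Lemma generated_conj_closed S :
  (forall x y, S x -> S (x ^ y)) -> is_normal_subgroup (subgroup_generated S).
Proof.
move=> SJ; split=> [|x y]; first exact: subgroup_generated_subgroup.
have [G1 GM GV] := subgroup_generated_subgroup S.
apply: (@subgroup_generated_min _ (fun x => subgroup_generated S (x ^ y))).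
  by split=> [|u v Su Sv|u Su]; rewrite ?conj1g ?conjMg ?conjVg; auto.
by move=> u Su; apply: subgroup_generated_sub; apply: SJ.
Qed.

(** Presenting the quotient as a group with a projection turns congruences
modulo a normal subgroup into equations, to which group identities apply. *)
Lemma quotient_group N : is_normal_subgroup N ->
  exists (Q : groupType) (pi : G -> Q),
    [/\ {morph pi : x y / x * y},
        (forall q, exists g, pi g = q) &
        (forall g, pi g = 1 <-> N g)].
Proof.
move=> [[N1 NM NV] NJ].
pose e := [rel x y : G | `[< N (x^-1 * y) >]].
have eP : equiv_class_of e.
  split=> [x|x y|y x z] /=; first by apply/asboolP; rewrite mulVg.
    by apply/asboolP/asboolP => /NV; rewrite invgM invgK.
  move=> /asboolP Nxy /asboolP Nyz; apply/asboolP.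
  by rewrite -(mulgK y (x^-1)) -mulgA; apply: NM.
pose eR := EquivRelPack eP.
pose Q := {eq_quot eR}%qT.
pose pi (x : G) : Q := (\pi_Q x)%qT.
have piE x y : pi x = pi y <-> N (x^-1 * y).
  by split=> [/eqquotP/asboolP|?] //; apply/eqquotP/asboolP.
have piK (q : Q) : pi (repr q) = q by exact: reprK.
pose mulQ (p q : Q) := pi (repr p * repr q).
pose invQ (q : Q) := pi (repr q)^-1.
have mulE x y : mulQ (pi x) (pi y) = pi (x * y).
  have /piE Nx := piK (pi x); have /piE Ny := piK (pi y).
  apply/piE; rewrite invgM.
  set u := repr (pi x) in Nx *; set v := repr (pi y) in Ny *.
  have -> : v^-1 * u^-1 * (x * y) = (u^-1 * x) ^ v * (v^-1 * y).
    by rewrite conjgE !mulgA mulgK.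
  by apply: NM => //; apply: NJ.
have invE x : invQ (pi x) = pi x^-1.
  have /piE Nx := piK (pi x); apply/piE; rewrite invgK.
  set u := repr (pi x) in Nx *.
  have -> : u * x^-1 = ((u^-1 * x)^-1) ^ u^-1.
    by rewrite conjgE invgM !invgK !mulgA mulgK.
  by apply/NJ/NV.
have mulA : associative mulQ.
  by move=> p q r; rewrite -(piK p) -(piK q) -(piK r) !mulE mulgA.
have mul1 : left_id (pi 1) mulQ by move=> q; rewrite -(piK q) mulE mul1g.
have mulr1 : right_id (pi 1) mulQ by move=> q; rewrite -(piK q) mulE mulg1.
have mulV : left_inverse (pi 1) invQ mulQ.
  by move=> q; rewrite -(piK q) invE mulE mulVg.
have mulrV : right_inverse (pi 1) invQ mulQ.
  by move=> q; rewrite -(piK q) invE mulE mulgV.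
pose QG : groupType := HB.pack Q (isGroup.Build Q mulA mul1 mulr1 mulV mulrV).
exists QG, pi; split=> [x y|q|g]; first by rewrite -mulE.
  by exists (repr q); apply: piK.
split=> [/esym/piE|Ng]; first by rewrite invg1 mul1g.
by apply/esym/piE; rewrite invg1 mul1g.
Qed.

End Subgroups.

Section LowerCentralSeries.
Local Open Scope classical_set_scope.
Local Open Scope group_scope.
Variable G : groupType.

Lemma gammaS c : gamma G c.+2 = commutator_subgroup (gamma G c.+1) setT.
Proof. by []. Qed.

Lemma gamma_normal c : is_normal_subgroup (gamma G c.+1).
Proof.
elim: c => [|c [_ IH]]; first by split; split.
rewrite gammaS; apply: generated_conj_closed => _ y [x gx] [z _ <-].
by rewrite conjRg; exists (x ^ y); [exact: IH|exists (z ^ y)].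
Qed.

Lemma commg_gamma c x y : gamma G c.+1 x -> gamma G c.+2 [~ x, y].
Proof.
move=> gx; rewrite gammaS; apply: subgroup_generated_sub.
by exists x => //; exists y.
Qed.

Lemma gamma_omegaP x : gamma_omega G x <-> forall c, gamma G c.+1 x.
Proof.
by split=> [gx c|gx [|c]] //; exact: gx.
Qed.

Lemma gamma_omega_normal : is_normal_subgroup (gamma_omega G).
Proof.
split; first split.
- by apply/gamma_omegaP => c; have [[]] := gamma_normal c.
- move=> x y /gamma_omegaP gx /gamma_omegaP gy; apply/gamma_omegaP => c.
  by have [[_ gM _] _] := gamma_normal c; apply: gM.
- move=> x /gamma_omegaP gx; apply/gamma_omegaP => c.
  by have [[_ _ gV] _] := gamma_normal c; apply: gV.
move=> x y /gamma_omegaP gx; apply/gamma_omegaP => c.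
by have [_ gJ] := gamma_normal c; apply: gJ.
Qed.

Import GRing.Theory.
Local Open Scope ring_scope.

(** The commutator identity
[x, y] - 1 = x^-1 y^-1 ((x - 1) (y - 1) - (y - 1) (x - 1)) raises the
filtration degree by one at each step of the lower central series.  As
[rho g = (rho g - 1) + 1], the hypotheses already make every [J c] stable
under multiplication by [rho g]. *)
Lemma gamma_filtration (R : pzRingType) (rho : G -> R) (J : nat -> R -> Prop) :
  {morph rho : x y / (x * y)%g >-> x * y} -> rho 1%g = 1 ->
  (forall c, J c 0) ->
  (forall c x y, J c x -> J c y -> J c (x - y)) ->
  (forall c x, J c.+1 x -> J c x) ->
  (forall c x y, J 1 x -> J c y -> J c.+1 (x * y)) ->
  (forall c x y, J c x -> J 1 y -> J c.+1 (x * y)) ->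
  (forall g, J 1 (rho g - 1)) ->
  forall c g, gamma G c.+1 g -> J c.+1 (rho g - 1).
Proof.
move=> rhoM rho1 J0 JB JW Jl Jr J1.
have JN c x : J c x -> J c (- x) by rewrite -sub0r; apply: JB.
have JD c x y : J c x -> J c y -> J c (x + y).
  by move=> Jx Jy; rewrite -[y]opprK; apply: JB => //; apply: JN.
have JMl c g x : J c x -> J c (rho g * x).
  by move=> Jx; rewrite -[rho g](subrK 1) mulrDl mul1r; apply: JD => //;
    apply/JW/Jl.
have rhoV g : rho g^-1%g * rho g = 1 by rewrite -rhoM mulVg.
elim=> [|c IH] g; first by move=> _; apply: J1.
rewrite gammaS.
apply: (@subgroup_generated_min _ _ (fun g => J c.+2 (rho g - 1))).
  split=> [|x y Jx Jy|x Jx]; first by rewrite rho1 subrr; apply: J0.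
    have -> : rho (x * y)%g - 1 = rho x * (rho y - 1) + (rho x - 1).
      by rewrite rhoM mulrBr mulr1 addrA subrK.
    by apply: JD => //; apply: JMl.
  have -> : rho x^-1%g - 1 = - (rho x^-1%g * (rho x - 1)).
    by rewrite mulrBr mulr1 rhoV opprB.
  by apply: JN; apply: JMl.
move=> _ [x gx] [y _ <-].
have -> : rho [~ x, y]%g - 1 = rho x^-1%g * (rho y^-1%g *
    ((rho x - 1) * (rho y - 1) - (rho y - 1) * (rho x - 1))).
  have -> : (rho x - 1) * (rho y - 1) - (rho y - 1) * (rho x - 1) =
      rho x * rho y - rho y * rho x.
    have exp_prod a b : (a + 1) * (b + 1) = a * b + (a + b + 1) :> R.
      by rewrite mulrDl mulrDr mul1r mulr1 !addrA.
    rewrite -[rho x in RHS](subrK 1) -[rho y in RHS](subrK 1) !exp_prod.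
    by rewrite [rho y - 1 + _]addrC opprD addrACA subrr addr0.
  by rewrite 2!mulrBr !mulrA -!rhoM -!mulgA mulKg mulVg rho1.
apply/JMl; apply/JMl; apply/JB.
  by apply: Jr => //; apply: IH.
by apply: Jl => //; apply: IH.
Qed.

End LowerCentralSeries.

(** * Maps out of presented groups *)

Section UniversalProperty.
Local Open Scope classical_set_scope.
Variables (T : Type) (idx : T) (op : Monoid.law idx).
Variables (X : choiceType) (R : set (word X * word X)) (f : X * bool -> T).

Definition word_eval (w : word X) : T := \big[op/idx]_(l <- w) f l.

(** The target is only required to be a monoid: the same statement then yields
homomorphisms to groups and multiplicative maps to matrix rings, where the
units need not be collected in a group. *)
Lemma pres_universal :
  (forall x b, op (f (x, b)) (f (x, ~~ b)) = idx) ->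
  (forall l r, R (l, r) -> word_eval l = word_eval r) ->
  exists h : presented R -> T,
    {morph h : x y / (x * y)%g >-> op x y} /\
    forall w, h (pres_pi R w) = word_eval w.
Proof.
move=> fV fR.
have evalP u v : pres_eq R u v -> word_eval u = word_eval v.
  elim=> //= {u v} => [u v w _ -> _ -> //|u v x b|u v l r /fR lr].
    rewrite /word_eval !big_cat !big_cons; congr (op _ _).
    apply: etrans (Monoid.mulmA op _ _ _) _.
    exact: etrans (congr1 (op^~ _) (fV x b)) (Monoid.mul1m op _).
  by move: lr; rewrite /word_eval !big_cat /= => ->.
pose h (x : presented R) := word_eval (pres_repr x).
have hE w : h (pres_pi R w) = word_eval w.
  by apply/evalP/pres_piP; rewrite pres_reprK.
exists h; split=> // x y.
rewrite -(pres_reprK x) -(pres_reprK y).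
have -> : (pres_pi R (pres_repr x) * pres_pi R (pres_repr y))%g =
  pres_pi R (pres_repr x ++ pres_repr y) by exact: pres_mulE.
by rewrite !hE /word_eval big_cat.
Qed.

End UniversalProperty.

Section BaumslagSolitar.
Local Open Scope classical_set_scope.
Local Open Scope group_scope.
Variables m n : int.
Local Notation G := (BS m n).
Local Notation a := (BS_a m n).
Local Notation t := (BS_t m n).

Lemma BS_piM u v : (pres_pi _ (u ++ v) : G) = pres_pi _ u * pres_pi _ v.
Proof. by symmetry; exact: pres_mulE. Qed.

Lemma BS_pi1 : (pres_pi _ [::] : G) = 1.
Proof. by []. Qed.

Lemma BS_piV x : (pres_pi _ [:: (x, true)] : G) = (pres_gen _ x)^-1.
Proof. by symmetry; exact: pres_invE. Qed.

Lemma BS_pi_exp x k : (pres_pi _ (word_exp x k) : G) = expgz (pres_gen _ x) k.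
Proof.
have exp_letter b g j : (pres_pi _ [:: (x, b)] : G) = g ->
    (pres_pi _ (nseq j (x, b)) : G) = g ^+ j.
  by move=> <-; elim: j => [|j IH] //; rewrite -[nseq _ _]cat1s BS_piM IH expgS.
case: k => k; first exact: exp_letter.
rewrite [RHS]/= -expVgn; apply: (exp_letter true); exact: BS_piV.
Qed.

Lemma BS_relation : t^-1 * expgz a m * t = expgz a n.
Proof.
have /pres_piP : pres_eq (BS_relations m n)
    (word_exp letter_t (- 1)%R ++ word_exp letter_a m ++ word_exp letter_t 1%R)
    (word_exp letter_a n).
  have := @pres_eq_rel _ (BS_relations m n) [::] [::] _ _ erefl.
  by rewrite !cats0.
by rewrite !BS_piM !BS_pi_exp /= expg1 mulgA.
Qed.

Lemma BS_generated (P : set G) :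
  P 1 -> (forall x y, P x -> P y -> P (x * y)) ->
  P a -> P a^-1 -> P t -> P t^-1 -> forall g, P g.
Proof.
move=> P1 PM Pa PaV Pt PtV g; rewrite -(pres_reprK g).
elim: (pres_repr g) => [|[x b] w IH]; first by rewrite BS_pi1.
rewrite -cat1s BS_piM; apply: PM => //.
by case: b; rewrite ?BS_piV //; case: x.
Qed.

(** In a monoid the images of the inverse letters must be supplied: they are
[A'] and [U'].  The two iterated products are the integer powers [A ^ m] and
[A ^ n]. *)
Lemma BS_universal (T : Type) (idx : T) (op : Monoid.law idx) (A A' U U' : T) :
  op A A' = idx -> op A' A = idx -> op U U' = idx -> op U' U = idx ->
  op U' (op (iter `|m| (op (if (m < 0)%R then A' else A)) idx) U) =
    iter `|n| (op (if (n < 0)%R then A' else A)) idx ->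
  exists h : G -> T,
    [/\ {morph h : x y / x * y >-> op x y}, h 1 = idx,
        (h a = A /\ h a^-1 = A') & (h t = U /\ h t^-1 = U')].
Proof.
move=> AA' A'A UU' U'U rel.
pose f (l : bs_letter * bool) :=
  match l with
  | (letter_a, false) => A | (letter_a, true) => A'
  | (letter_t, false) => U | (letter_t, true) => U'
  end.
have fV x b : op (f (x, b)) (f (x, ~~ b)) = idx by case: x b => [] [].
have eval_exp x k : word_eval op f (word_exp x k) =
    iter `|k| (op (f (x, (k < 0)%R))) idx.
  by rewrite /word_eval /word_exp big_nseq.
have eval_cat u v :
    word_eval op f (u ++ v) = op (word_eval op f u) (word_eval op f v).
  by rewrite /word_eval big_cat.
have fR l r : BS_relations m n (l, r) -> word_eval op f l = word_eval op f r.
  move=> lr; rewrite (congr1 fst lr : l = _ ++ _ ++ _).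
  rewrite (congr1 snd lr : r = word_exp _ _).
  rewrite !eval_cat !eval_exp /= !Monoid.mulm1.
  by move: rel; case: (m < 0)%R; case: (n < 0)%R.
have [h [hM hE]] := pres_universal fV fR.
have h_letter x b : h (pres_pi _ [:: (x, b)]) = f (x, b).
  by rewrite hE /word_eval big_seq1.
exists h; split=> //; first by rewrite -BS_pi1 hE /word_eval big_nil.
  by split; [exact: h_letter letter_a false|rewrite -BS_piV h_letter].
by split; [exact: h_letter letter_t false|rewrite -BS_piV h_letter].
Qed.

Lemma BS_hom (Q : groupType) (alpha tau : Q) :
  tau^-1 * expgz alpha m * tau = expgz alpha n ->
  exists h : G -> Q, [/\ {morph h : x y / x * y}, h a = alpha & h t = tau].
Proof.
move=> rel.
have expE k : iter `|k| (fun z => (if (k < 0)%R then alpha^-1 else alpha) * z) 1 =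
    expgz alpha k.
  case: k => k; last by rewrite iter_mulg mulg1 expVgn.
  by have -> : (Posz k < 0)%R = false by []; rewrite iter_mulg mulg1.
have [|h [hM _ [ha _] [ht _]]] := @BS_universal Q 1 (@mul Q)
    alpha alpha^-1 tau tau^-1 (mulgV _) (mulVg _) (mulgV _) (mulVg _).
  by rewrite /= !expE mulgA rel.
by exists h.
Qed.

End BaumslagSolitar.

(** * Central commutators of conjugate powers *)

(** A prime occurs in [x] at most [x] times.  The point is that the exponent
[x] no longer depends on [k]. *)
Lemma dvdn_exp_base (x m k : nat) : (0 < x)%N -> (x %| m ^ k -> x %| m ^ x)%N.
Proof.
move=> x_gt0 x_mk; apply/(dvdn_partP _ x_gt0) => p.
rewrite mem_primes => /and3P[p_pr _ p_x]; rewrite p_part.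
have p_m : (p %| m)%N.
  by move: (dvdn_trans p_x x_mk); rewrite Euclid_dvdX // => /andP[].
apply: dvdn_trans (dvdn_exp2r _ p_m); apply: dvdn_exp2l.
by apply: ltnW; apply: ltn_logl.
Qed.

Section Bezout.
Local Open Scope group_scope.
Variable G : groupType.
Implicit Types (x : G) (i j : int).

Lemma expgz_dvd x i j : (i %| j)%Z -> expgz x i = 1 -> expgz x j = 1.
Proof.
by move=> /dvdzP[k ->] xi; rewrite GRing.mulrC expgzM xi expgz1.
Qed.

Lemma expgz_gcd x i j :
  expgz x i = 1 -> expgz x j = 1 -> expgz x (gcdz i j) = 1.
Proof.
move=> xi xj; have [u [v <-]] := Bezoutz i j.
by rewrite expgzD (GRing.mulrC u) (GRing.mulrC v) !expgzM xi xj !expgz1 mulg1.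
Qed.

(** Additively, m1 F_(k+1) = n1 F_k and mu n1 F_(k+1) = mu m1 F_k.  If
mu F_k = 0, then m1 and n1 both kill mu F_(k+1), hence mu F_(k+1) = 0; and
m1^k F_k = 0 by induction.  So F_k is killed by gcd(mu, m1^k), a divisor of
m1^mu whatever k is.  This uniform bound gives
n1^mu F_k = m1^mu F_(k+mu) = 0, and F_k = 0 because n1^mu and m1^k are
coprime. *)
Lemma rational_chain_trivial (m1 n1 : int) (mu : nat) (F : nat -> G) :
  coprimez m1 n1 -> (0 < mu)%N -> F 0 = 1 ->
  (forall k, expgz (F k.+1) m1 = expgz (F k) n1) ->
  (forall k, expgz (F k.+1) (n1 * mu%:Z)%R = expgz (F k) (m1 * mu%:Z)%R) ->
  forall k, F k = 1.
Proof.
move=> co mu_gt0 F0 step step_mu.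
have Fmu k : expgz (F k) mu%:Z = 1.
  elim: k => [|k IH]; first by rewrite F0 expgz1.
  apply: (expgz_coprime_eq1 co); rewrite -expgzM GRing.mulrC.
    by rewrite expgzM step expgzAC IH expgz1.
  by rewrite step_mu GRing.mulrC expgzM IH expgz1.
have Fm1 k : expgz (F k) (m1 ^+ k)%R = 1.
  elim: k => [|k IH]; first by rewrite F0 expgz1.
  by rewrite GRing.exprS expgzM step expgzAC IH expgz1.
have shift s k : expgz (F (k + s)) (m1 ^+ s)%R = expgz (F k) (n1 ^+ s)%R.
  elim: s => [|s IH]; first by rewrite addn0.
  by rewrite addnS !GRing.exprS expgzM step expgzAC IH -expgzM GRing.mulrC.
have Fbound k : expgz (F k) (m1 ^+ mu)%R = 1.
  have := expgz_gcd (Fmu k) (Fm1 k); apply: expgz_dvd.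
  rewrite /dvdz /gcdz /= abszX; set x := gcdn _ _.
  have x_gt0 : (0 < x)%N by rewrite gcdn_gt0 mu_gt0.
  apply: dvdn_trans (dvdn_exp_base x_gt0 (dvdn_gcdr _ _)) _.
  rewrite abszX; apply: dvdn_exp2l; apply: dvdn_leq => //; apply: dvdn_gcdl.
move=> k; apply: (@expgz_coprime_eq1 _ _ (m1 ^+ k)%R (n1 ^+ mu)%R) => //.
  by rewrite coprimezXl // coprimezXr.
by rewrite -shift Fbound.
Qed.

(** Read downwards from 0, the two recursions exchange the roles of [m1] and
[n1]. *)
Lemma rational_chain_trivialz (m1 n1 : int) (mu : nat) (F : int -> G) :
  coprimez m1 n1 -> (0 < mu)%N -> F 0%R = 1 ->
  (forall k, expgz (F (k + 1)%R) m1 = expgz (F k) n1) ->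
  (forall k, expgz (F (k + 1)%R) (n1 * mu%:Z)%R = expgz (F k) (m1 * mu%:Z)%R) ->
  forall k, F k = 1.
Proof.
move=> co mu_gt0 F0 step step_mu [k|k].
  refine (@rational_chain_trivial m1 n1 mu (fun h => F (Posz h)) co mu_gt0 F0
    _ _ k); move=> {}k.
    by rewrite -addn1 PoszD step.
  by rewrite -addn1 PoszD step_mu.
rewrite NegzE; move: k.+1 => {}k.
apply: (@rational_chain_trivial n1 m1 mu (fun h => F (- Posz h)%R)) => //.
- by rewrite coprimez_sym.
- move=> h; have := step (- h.+1%:Z)%R.
  by rewrite -[in (- _ + 1)%R]addn1 PoszD GRing.opprD GRing.subrK => ->.
- move=> h; have := step_mu (- h.+1%:Z)%R.
  by rewrite -[in (- _ + 1)%R]addn1 PoszD GRing.opprD GRing.subrK => ->.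
Qed.

End Bezout.

Section Commutators.
Local Open Scope group_scope.

(** Writing C_k for the commutator, centrality makes it bilinear in powers of
its entries, and C_k is invariant under conjugation by [tau].  The relation
between consecutive [x k] used in the first entry gives
nu m1 C_(k+1) = nu n1 C_k; used in the second entry, after conjugating C_k by
[tau], it gives mu n1 C_(k+1) = mu m1 C_k.  With 1 = u mu + v nu, each of the
multiples u mu C_k and v nu C_k satisfies one of these recursions exactly and
the other up to a factor, so both vanish. *)
Lemma central_commutators_trivial (Q : groupType) (alpha tau : Q)
    (m1 n1 : int) (mu nu : nat) :
  coprimez m1 n1 -> coprime mu nu -> (0 < mu)%N -> (0 < nu)%N ->
  let x k := alpha ^ expgz tau k in
  (forall k : int, expgz (x (k + 1)%R) ((mu * nu)%:Z * m1)%R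
                   = expgz (x k) ((mu * nu)%:Z * n1)%R) ->
  (forall k g, commute [~ x k ^+ mu, alpha ^+ nu] g) ->
  forall k, [~ x k ^+ mu, alpha ^+ nu] = 1.
Proof.
move=> co_m1n1 co mu_gt0 nu_gt0 x rel cen.
have x0 : x 0%R = alpha by rewrite /x conjg1.
pose C k := [~ x k ^+ mu, alpha ^+ nu].
have C0 : C 0%R = 1.
  by rewrite /C x0; apply/eqP/commgP/commuteX2.
have CX k i : expgz (C k) i = [~ expgz (x k) (mu%:Z * i)%R, alpha ^+ nu].
  by rewrite expgzM commgXz //; apply: cen.
have CXr k i : expgz (C k) i = [~ x k ^+ mu, expgz alpha (nu%:Z * i)%R].
  by rewrite expgzM commgzX //; apply: cen.
have relr k : expgz (C (k + 1)%R) (m1 * nu%:Z)%R = expgz (C k) (n1 * nu%:Z)%R.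
  by rewrite !CX ![(_ * nu%:Z)%R]GRing.mulrC !GRing.mulrA -!PoszM rel.
have rell k : expgz (C (k + 1)%R) (n1 * mu%:Z)%R = expgz (C k) (m1 * mu%:Z)%R.
  have xS : x (k + 1)%R = x k ^ tau by rewrite /x expgzD conjgM.
  have x1 : x 1%R = alpha ^ tau by [].
  have fix_tau : expgz (C k) (m1 * mu%:Z)%R ^ tau = expgz (C k) (m1 * mu%:Z)%R.
    by apply/conjg_fixP/commgP/commute_expgz/cen.
  rewrite -fix_tau CXr [in RHS]CXr conjRg conjXg -xS conjXz -x1.
  rewrite ![(_ * mu%:Z)%R]GRing.mulrC !GRing.mulrA -!PoszM (mulnC nu).
  by have := rel 0%R; rewrite GRing.add0r x0 => ->.
have /coprimezP[[u v] /= uv] : coprimez mu%:Z nu%:Z by [].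
have expgz_swap y i j k :
    expgz (expgz y (i * j)%R) k = expgz (expgz y (k * j)%R) i :> Q.
  rewrite -!expgzM [(i * j * k)%R]GRing.mulrC.
  by rewrite [in RHS]GRing.mulrAC GRing.mulrA.
have C_split k : expgz (C k) (u * mu%:Z)%R = 1 ->
    expgz (C k) (v * nu%:Z)%R = 1 -> C k = 1.
  by move=> Eu Ev; rewrite -[C k]/(expgz (C k) 1%R) -uv expgzD Eu Ev mulg1.
move=> k; apply: C_split; move: k.
  apply: (@rational_chain_trivialz _ n1 m1 nu
    (fun k => expgz (C k) (u * mu%:Z)%R)) => // [||k|k].
  - by rewrite coprimez_sym.
  - by rewrite C0 expgz1.
  - by rewrite (expgz_swap (C (k + 1)%R)) (expgz_swap (C k)) rell.
  - by rewrite expgzAC relr expgzAC.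
apply: (@rational_chain_trivialz _ m1 n1 mu
    (fun k => expgz (C k) (v * nu%:Z)%R)) => // [|k|k].
- by rewrite C0 expgz1.
- by rewrite (expgz_swap (C (k + 1)%R)) (expgz_swap (C k)) relr.
- by rewrite expgzAC rell expgzAC.
Qed.

End Commutators.

(** * Elements of gamma_omega *)

Section LowerBound.
Local Open Scope classical_set_scope.
Local Open Scope group_scope.

Lemma conj_relation (Q : groupType) (alpha tau : Q) (m n k : int) :
  tau^-1 * expgz alpha m * tau = expgz alpha n ->
  expgz (alpha ^ expgz tau (k + 1)%R) m = expgz (alpha ^ expgz tau k) n.
Proof.
move=> rel; rewrite GRing.addrC expgzD conjgM -!conjXz /= expg1.
by rewrite [expgz alpha m ^ _]conjgE mulgA rel.
Qed.

Lemma BS_commutatorE m n k mu nu :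
  [~ expgz (BS_t m n) (- k)%R * BS_a m n ^+ mu * expgz (BS_t m n) k,
     BS_a m n ^+ nu] =
  [~ (BS_a m n ^ expgz (BS_t m n) k) ^+ mu, BS_a m n ^+ nu].
Proof. by rewrite expgzN -mulgA -conjgE conjXg. Qed.

(** If all the commutators for the given mu and nu lie in one term of the lower
central series, they are central modulo the next term, hence trivial there.
The induction has to carry all [k] at once. *)
Lemma BS_commutators_gamma_omega (m n : int) (d : nat) (m1 n1 : int) :
  coprimez m1 n1 -> m = (d%:Z * m1)%R -> n = (d%:Z * n1)%R ->
  BS_commutators m n d `<=` gamma_omega (BS m n).
Proof.
move=> co mE nE _ [k [mu [nu [mu_gt0 nu_gt0 co_mu dE ->]]]].
rewrite BS_commutatorE; apply/gamma_omegaP => c; elim: c k => [//|c IH] k.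
have [Q [pi [piM pi_onto piK]]] := quotient_group (gamma_normal (BS m n) c.+1).
have [pi1 piV piJ piR piX] := group_morphism piM.
have piE j : pi (BS_a m n ^ expgz (BS_t m n) j) =
    pi (BS_a m n) ^ expgz (pi (BS_t m n)) j.
  by rewrite piJ (morph_expgz piM).
apply/piK; rewrite piR !piX piE.
apply: (@central_commutators_trivial Q (pi (BS_a m n)) (pi (BS_t m n)) m1 n1)
  => // [|j|j q].
- exact/eqP.
- rewrite dE -mE -nE; apply: conj_relation.
  by rewrite -!(morph_expgz piM) -piV -!piM BS_relation.
- have [x <-] := pi_onto q.
  rewrite -piE -!piX -piR; apply/commgP; rewrite -piR; apply/eqP/piK.
  exact: commg_gamma.
Qed.

(** An integer without prime divisors is 1 or -1, so a^(n - m), which is the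
commutator of a^m and t, is a^d or its inverse. *)
Lemma BS_power_gamma_omega (m n : int) (d : nat) (m1 n1 : int) :
  m = (d%:Z * m1)%R -> n = (d%:Z * n1)%R ->
  (forall p : nat, prime p -> (n1 <> m1 %[mod Posz p])%Z) ->
  gamma_omega (BS m n) (BS_a m n ^+ d).
Proof.
move=> mE nE nomod.
have unit_diff : `|(n1 - m1)%R|%N = 1%N.
  apply/eqP; apply: contraT => diff_neq1.
  have [p p_pr p_diff] : exists2 p, prime p & (p %| `|(n1 - m1)%R|)%N.
    have [->|diff_neq0] := eqVneq `|(n1 - m1)%R|%N 0%N; first by exists 2%N.
    exists (pdiv `|(n1 - m1)%R|); last exact: pdiv_dvd.
    by apply: pdiv_prime; case: `|_|%N diff_neq0 diff_neq1 => [|[]].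
  by case: (nomod p p_pr); apply/eqP; rewrite eqz_mod_dvd.
have diffE : [~ expgz (BS_a m n) m, BS_t m n] = expgz (BS_a m n) (n - m)%R.
  rewrite commgEl conjgE (mulgA (BS_t m n)^-1) BS_relation -expgzN -expgzD.
  by rewrite GRing.addrC.
have sE : ((n1 - m1) * (n - m) = Posz d)%R.
  rewrite mE nE -GRing.mulrBr GRing.mulrCA.
  suff -> : ((n1 - m1) * (n1 - m1) = 1)%R by rewrite GRing.mulr1.
  by case: (n1 - m1)%R unit_diff => [[|[]]|[]].
apply/gamma_omegaP; elim=> [//|c IH].
have [sgN NJ] := gamma_normal (BS m n) c.+1.
rewrite -[_ ^+ d]/(expgz _ (Posz d)) -sE GRing.mulrC expgzM.
apply: (subgroup_expgz _ sgN); rewrite -diffE.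
apply: commg_gamma.
have -> : expgz (BS_a m n) m = expgz (expgz (BS_a m n) (Posz d)) m1.
  by rewrite -expgzM -mE.
have [sg _] := gamma_normal (BS m n) c.
exact: (subgroup_expgz m1 sg IH).
Qed.

End LowerBound.

(** * Unitriangular matrices attached to a word *)

Section Shifts.
Import GRing.Theory.
Local Open Scope ring_scope.
Variables (p : nat) (F : fieldType) (X : eqType) (x0 : X) (w : seq X).
Hypothesis pcharF : p \in [pchar F].
Local Notation L := (size w).
Local Notation M := 'M[F]_L.+1.
Implicit Types (x y : X) (A B : M).

(** The positions between the letters of [w] are the states, and [shift x]
advances by one position wherever the next letter is [x].  These matrices play
the part of the noncommuting variables of a power series ring, of which only
the factors of the monomial [w] are kept. *)
Definition shift x : M :=
  \matrix_(i, j) ((j == i.+1 :> nat) && (nth x0 w i == x))%:R.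

(** Rows are sources and columns are targets: every move of [A] goes at least
[k] positions forward and reads nothing but the letter [x]. *)
Definition moves_along x k A := forall i j : 'I_L.+1, A i j != 0 ->
  (i + k <= j)%N /\ forall h, (i <= h < j)%N -> nth x0 w h = x.

Definition moves_forward k A :=
  forall i j : 'I_L.+1, A i j != 0 -> (i + k <= j)%N.

Lemma mulmx_neq0 A B i j : (A * B) i j != 0 ->
  exists2 h, A i h != 0 & B h j != 0.
Proof.
move=> AB; apply: contrapT => no_h; move/eqP: AB; apply.
rewrite mxE big1 // => h _; apply/eqP; rewrite mulf_eq0.
by apply: contraT; rewrite negb_or => /andP[Ah Bh]; case: no_h; exists h.
Qed.

Lemma moves_forwardM k l A B :
  moves_forward k A -> moves_forward l B -> moves_forward (k + l) (A * B).
Proof.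
move=> mA mB i j /mulmx_neq0[h /mA ih /mB hj].
by apply: leq_trans hj; rewrite addnA leq_add2r.
Qed.

Lemma moves_alongM x k l A B :
  moves_along x k A -> moves_along x l B -> moves_along x (k + l) (A * B).
Proof.
move=> mA mB i j /mulmx_neq0[h /mA[ih run_ih] /mB[hj run_hj]]; split=> [|u].
  by apply: leq_trans hj; rewrite addnA leq_add2r.
case/andP=> iu uj; have [uh|hu] := ltnP u h.
  by apply: run_ih; rewrite iu.
by apply: run_hj; rewrite hu.
Qed.

Lemma moves_along1 x : moves_along x 0 1.
Proof.
move=> i j; rewrite mxE; case: (i =P j) => [<- _|_]; last by rewrite eqxx.
by rewrite addn0; split=> // h /andP[ih /(leq_ltn_trans ih)]; rewrite ltnn.
Qed.

Lemma moves_alongD x A B :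
  moves_along x 0 A -> moves_along x 0 B -> moves_along x 0 (A + B).
Proof.
move=> mA mB i j; rewrite mxE; have [->|/mA //] := eqVneq (A i j) 0.
by rewrite add0r => /mB.
Qed.

Lemma moves_alongW x k A : moves_along x k A -> moves_along x 0 A.
Proof.
move=> mA i j /mA[ij run]; split=> //; rewrite addn0.
by apply: leq_trans ij; apply: leq_addr.
Qed.

Lemma moves_alongX x k A n :
  moves_along x k A -> moves_along x (k * n) (A ^+ n).
Proof.
move=> mA; elim: n => [|n IH]; first by rewrite muln0; apply: moves_along1.
by rewrite exprS mulnS; apply: moves_alongM.
Qed.

Lemma moves_along_shift x : moves_along x 1 (shift x).
Proof.
move=> i j; rewrite mxE.
case: (nat_of_ord j =P i.+1) => [jE|_]; last by rewrite eqxx.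
case: (nth x0 w i =P x) => [wi|_]; last by rewrite eqxx.
move=> _; rewrite addn1 jE; split=> // h; rewrite ltnS -eqn_leq => /eqP <- //.
Qed.

Lemma moves_along_unipotent x n : moves_along x 0 ((1 + shift x) ^+ n).
Proof.
rewrite -(mul0n n); apply: moves_alongX; apply: moves_alongD.
  exact: moves_along1.
exact: (@moves_alongW x 1 _ (@moves_along_shift x)).
Qed.

Lemma unipotent_pchar_exp A e : (1 + A) ^+ (p ^ e) = 1 + A ^+ (p ^ e).
Proof.
have pcharM : p \in [pchar M] by rewrite pchar_lalg.
elim: e => [|e IH]; first by rewrite expn0 !expr1.
rewrite expnSr !exprM IH -!(pFrobenius_autE pcharM).
rewrite pFrobenius_autD_comm ?pFrobenius_aut1 //.
by apply: commr_sym; apply: commr1.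
Qed.

(** In characteristic p the power is 1 + X^(p^e), and X^(p^e) has to read p^e
consecutive letters [x]. *)
Lemma unipotent_order x e :
  (forall i, (i + p ^ e <= L)%N ->
     exists2 h, (i <= h < i + p ^ e)%N & nth x0 w h != x) ->
  (1 + shift x) ^+ (p ^ e) = 1.
Proof.
move=> no_run; rewrite unipotent_pchar_exp.
suff -> : shift x ^+ (p ^ e) = 0 by rewrite addr0.
apply/matrixP => i j; rewrite [RHS]mxE; apply/eqP; apply: contraT => Aij.
have [] := @moves_alongX x 1 _ (p ^ e) (@moves_along_shift x) i j Aij.
rewrite mul1n => ij run.
have [|h /andP[ih hi]] := no_run i.
  by apply: leq_trans ij _; rewrite -ltnS.
by rewrite run ?eqxx // ih (leq_trans hi).
Qed.

(** A row vector stands for the set of positions reached by the part of a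
product of matrices that has been evaluated: [k] is the farthest one, and it is
reached in one way. *)
Definition reaches k (v : 'rV[F]_L.+1) :=
  forall j : 'I_L.+1, (k <= j)%N -> v 0 j = (k == j :> nat)%:R.

Lemma reaches_step k x (v : 'rV[F]_L.+1) B :
  (k < L)%N -> nth x0 w k = x -> reaches k v ->
  (forall i j : 'I_L.+1, (i <= k.+1 <= j)%N ->
     B i j = ((k.+1 == i :> nat) && (k.+1 == j :> nat))%:R) ->
  reaches k.+1 (v *m ((1 + shift x) * B)).
Proof.
move=> kL wk vk Bk j kj.
pose v' := v *m (1 + shift x).
have v'E (i : 'I_L.+1) : (k < i)%N -> v' 0 i = (k.+1 == i :> nat)%:R.
  move=> ki; rewrite /v' mulmxDr mulmx1 mxE vk ?(ltnW ki) //.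
  rewrite (ltn_eqF ki) add0r mxE.
  pose i' : 'I_L.+1 := inord i.-1.
  have i'E : i' = i.-1 :> nat.
    by rewrite inordK //; case: (i : nat) (ltn_ord i) => // u /ltnW.
  have ik : (k <= i')%N by rewrite i'E -ltnS prednK //; case: (i : nat) ki.
  rewrite (bigD1 i') //= big1 ?addr0 => [|u ui'].
    have iE : i = i'.+1 :> nat by rewrite i'E prednK //; case: (i : nat) ki.
    rewrite vk // mxE iE !eqSS eqxx /=.
    by case: (k =P i') => [<-|_]; rewrite ?wk ?eqxx ?mul1r ?mul0r.
  rewrite mxE; case: (nat_of_ord i =P u.+1) => [iu|_]; last by rewrite mulr0.
  by case/eqP: ui'; apply: val_inj; rewrite /= i'E iu.
rewrite mulmxA -/v' mxE.
pose k1 : 'I_L.+1 := inord k.+1.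
have k1E : k1 = k.+1 :> nat by rewrite inordK.
rewrite (bigD1 k1) //= big1 ?addr0 => [|u uk1].
  by rewrite v'E k1E // Bk k1E ?leqnn ?eqxx ?mul1r.
have [uk|ku] := leqP u k.+1.
  rewrite Bk ?uk //; case: eqP => [k1u|_]; last by rewrite mulr0.
  by case/eqP: uk1; apply: val_inj; rewrite /= k1E.
by rewrite v'E ?(ltnW ku) // (ltn_eqF ku) mul0r.
Qed.

Lemma moves_forwardD k A B :
  moves_forward k A -> moves_forward k B -> moves_forward k (A + B).
Proof.
move=> mA mB i j; rewrite mxE; have [->|/mA //] := eqVneq (A i j) 0.
by rewrite add0r => /mB.
Qed.

Definition unitriangular A := moves_forward 1 (A - 1).

Lemma unitriangular1 : unitriangular 1.
Proof. by move=> i j; rewrite subrr mxE eqxx. Qed.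

Lemma unitriangularM A B :
  unitriangular A -> unitriangular B -> unitriangular (A * B).
Proof.
move=> uA uB; rewrite /unitriangular.
have -> : A * B - 1 = (A - 1) * (B - 1) + (B - 1) + (A - 1).
  by rewrite mulrBl mul1r subrK mulrBr mulr1 addrA subrK.
do 2 apply: moves_forwardD => //.
by move=> i j /(moves_forwardM uA uB); apply: leq_trans; rewrite leq_add2l.
Qed.

Lemma unitriangularX A n : unitriangular A -> unitriangular (A ^+ n).
Proof.
move=> uA; elim: n => [|n IH]; first exact: unitriangular1.
by rewrite exprS; apply: unitriangularM.
Qed.

Lemma unitriangular_shift x : unitriangular (1 + shift x).
Proof. by rewrite /unitriangular addrC addKr => i j /moves_along_shift[]. Qed.

Lemma unitriangular_diag A i : unitriangular A -> A i i = 1.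
Proof.
move=> uA; apply/eqP; apply: contraT; rewrite -subr_eq0 => Aii.
have /uA : (A - 1) i i != 0 by rewrite !mxE eqxx.
by rewrite addn1 ltnn.
Qed.

(** Only the first factor can read the letter at [k].  The second one reads runs
of [y] alone: such a run neither contains the position [k], where the letter is
[x], nor starts at [k.+1]. *)
Lemma reaches_next k x y (v : 'rV[F]_L.+1) N :
  (k < L)%N -> nth x0 w k = x -> x != y ->
  ((k.+1 < L)%N -> nth x0 w k.+1 != y) -> reaches k v ->
  reaches k.+1 (v *m ((1 + shift x) * (1 + shift y) ^+ N)).
Proof.
move=> kL wk xy wk1 vk; apply: reaches_step => // i j /andP[ik kj].
have [ki|ki] := eqVneq k.+1 i; last first.
  apply/eqP; apply: contraT => /moves_along_unipotent[_ run].
  case/eqP: xy; rewrite -wk run //; move: ik kj; rewrite leq_eqVlt eq_sym.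
  by rewrite (negPf ki) /= ltnS => -> ->.
have [kjE|kj'] := eqVneq k.+1 j.
  have -> : i = j by apply: val_inj; rewrite /= -ki.
  apply: unitriangular_diag; apply: unitriangularX.
  exact: unitriangular_shift.
apply/eqP; apply: contraT => /moves_along_unipotent[_ run].
have kj2 : (k.+1 < j)%N by rewrite ltn_neqAle kj'.
have /wk1/eqP[] : (k.+1 < L)%N by apply: leq_trans kj2 _; rewrite -ltnS.
by rewrite run // -ki leqnn.
Qed.

End Shifts.

(** * Residual nilpotence of the free product of Z/q and Z *)

Section MagnusRepresentation.
Import GRing.Theory.
Local Open Scope ring_scope.
Variables (p e : nat) (m n : int).
Hypotheses (p_pr : prime p) (qm : (p ^ e %| `|m|)%N) (qn : (p ^ e %| `|n|)%N).
Local Notation F := 'F_p.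
Local Notation G := (BS m n).
Local Notation a := (BS_a m n).
Local Notation t := (BS_t m n).
Local Notation q := (p ^ e)%N.
Local Notation letter := (bs_letter * bool)%type.
Local Notation x0 := (letter_a, false).

Definition letter_inv (l : letter) : letter := (l.1, ~~ l.2).

(** These words are the normal forms of the free product of Z/q and Z when the
powers of the generator of Z/q are written with exponents between 0 and q. *)
Definition reduced_word (w : word bs_letter) :=
  [/\ (letter_a, true) \notin w,
      forall i, (i + q <= size w)%N ->
        exists2 h, (i <= h < i + q)%N & nth x0 w h != x0 &
      forall i, (i.+1 < size w)%N -> nth x0 w i.+1 != letter_inv (nth x0 w i)].

(** Here a goes to 1 + A and t to (1 + T) (1 + T')^-1, with one variable T for
the letter t of [w] and another one T' for the letter t^-1.  With separate
variables each letter of [w] advances by exactly one position along [w], with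
coefficient 1: the factor (1 + T')^-1 in the image of t could go further only
by reading t^-1 just after t, which does not occur in a reduced word.  So the
image of [w] has the entry 1 in its upper right corner. *)
Lemma magnus_representation (w : word bs_letter) : reduced_word w ->
  exists rho : G -> 'M[F]_((size w).+1),
    [/\ {morph rho : x y / (x * y)%g >-> x * y}, rho 1%g = 1,
        forall g, unitriangular (rho g), rho (a ^+ q)%g = 1 &
        rho (pres_pi _ w) ord0 ord_max = 1].
Proof.
move=> [no_aV no_run no_cancel].
pose L := size w; pose P := (p ^ L)%N.
have P_gt0 : (0 < P)%N by rewrite expn_gt0 prime_gt0.
have LP : (L < P)%N by apply: ltn_expl; apply: prime_gt1.
pose Y l : 'M[F]_L.+1 := 1 + shift F x0 w l.
have pcharF := pchar_Fp p_pr.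
(* P exceeds the length of every run, so that Y^(P - 1) is the inverse of Y. *)
have YP l : Y l ^+ P = 1.
  apply: (unipotent_order pcharF) => i iP.
  by have := leq_trans LP (leq_trans (leq_addl i _) iP); rewrite ltnn.
have Yq : Y x0 ^+ q = 1 by apply: (unipotent_order pcharF).
have YV l : Y l * Y l ^+ P.-1 = 1 by rewrite -exprS prednK.
have VY l : Y l ^+ P.-1 * Y l = 1 by rewrite -exprSr prednK.
have uY l : unitriangular (Y l) by apply: unitriangular_shift.
pose A := Y x0; pose A' := Y x0 ^+ P.-1.
have A'q : A' ^+ q = 1 by rewrite /A' exprAC Yq expr1n.
pose T := (letter_t, false); pose T' := (letter_t, true).
pose U := Y T * Y T' ^+ P.-1; pose U' := Y T' * Y T ^+ P.-1.
have UU' : U * U' = 1 by rewrite /U /U' mulrA -[Y T * _ * _]mulrA VY mulr1 YV.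
have U'U : U' * U = 1 by rewrite /U /U' mulrA -[Y T' * _ * _]mulrA VY mulr1 YV.
have relX k : (q %| `|k|)%N ->
    iter `|k| ( *%R (if (k < 0)%R then A' else A)) 1 = 1.
  case/dvdnP=> s ->; rewrite iter_mulr_1 mulnC exprM.
  by case: ifP => _; rewrite ?Yq ?A'q expr1n.
have [|rho [rhoM rho1 [rhoa rhoaV] [rhot rhotV]]] := @BS_universal m n _ 1
    *%R A A' U U' (YV _) (VY _) UU' U'U.
  by rewrite /= !relX // mul1r.
exists rho.
have uX := unitriangularX.
have rho_uni g : unitriangular (rho g).
  move: g; apply: BS_generated.
  - by rewrite rho1; apply: unitriangular1.
  - by move=> x y ux uy; rewrite rhoM; apply: unitriangularM.
  - by rewrite rhoa; apply: uY.
  - by rewrite rhoaV; apply: uX.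
  - by rewrite rhot; apply: unitriangularM => //; apply: uX.
  - by rewrite rhotV; apply: unitriangularM => //; apply: uX.
have rhoX x k : rho (x ^+ k)%g = rho x ^+ k.
  by elim: k => [|k IH]; rewrite ?expr0 // expgS rhoM IH exprS.
split=> //; first by rewrite rhoX rhoa.
have rho_letter l : l != (letter_a, true) ->
    exists2 N, rho (pres_pi _ [:: l]) = Y l * Y (letter_inv l) ^+ N & True.
  case: l => [[] []] // _; last first.
  - by exists P.-1.
  - by exists P.-1; rewrite // BS_piV rhotV.
  - by exists 0%N; rewrite // expr0 mulr1.
have reach k : (k <= L)%N ->
    reaches k (delta_mx ord0 ord0 *m rho (pres_pi _ (take k w))).
  elim: k => [|k IH] kL.
    by move=> j _; rewrite take0 BS_pi1 rho1 mulmx1 mxE eqxx eq_sym.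
  rewrite (take_nth x0) // -cats1 BS_piM rhoM mulmxA.
  have wk_in : nth x0 w k \in w by apply: mem_nth.
  have [|N -> _] := rho_letter (nth x0 w k).
    by apply: contraNneq no_aV => <-.
  apply: reaches_next => //; last exact: IH (ltnW kL).
    by case: (nth x0 w k) => [[] []].
  exact: no_cancel.
have := reach L (leqnn L) ord_max (leqnn _).
by rewrite take_size eqxx -rowE mxE.
Qed.

Local Open Scope classical_set_scope.

(** A shortest word over a, t and t^-1 that represents the coset is reduced:
a run of q letters a or a pair of inverse letters could be deleted. *)
Lemma reduced_representative (Q : groupType) (pi : G -> Q) :
  {morph pi : x y / (x * y)%g} -> (pi a ^+ q)%g = 1%g ->
  forall g, exists2 w, reduced_word w & pi (pres_pi _ w) = pi g.
Proof.
move=> piM aq g.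
have [pi1 piV _ _ piX] := group_morphism piM.
pose ev w := pi (pres_pi (BS_relations m n) w).
have evM u v : ev (u ++ v) = (ev u * ev v)%g by rewrite /ev BS_piM piM.
have q_gt0 : (0 < q)%N by rewrite expn_gt0 prime_gt0.
have ev_run k : ev (nseq k x0) = (pi a ^+ k)%g.
  elim: k => [|k IH]; first by rewrite /ev BS_pi1.
  by rewrite -[nseq _ _]cat1s evM IH expgS.
have rep : exists w, (letter_a, true) \notin w /\ ev w = pi g.
  move: g; apply: BS_generated.
  - by exists [::].
  - move=> x y [u [au eu]] [v [av ew]]; exists (u ++ v).
    by rewrite mem_cat negb_or au av evM eu ew piM.
  - by exists [:: x0].
  - exists (nseq q.-1 x0); split; first by rewrite mem_nseq andbF.
    rewrite ev_run piV; apply: (@mulgI _ (pi a)).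
    by rewrite -expgS prednK // aq mulgV.
  - by exists [:: (letter_t, false)].
  - by exists [:: (letter_t, true)]; rewrite /ev BS_piV.
pose hasrep k := `[< exists w,
  [/\ (letter_a, true) \notin w, ev w = pi g & size w = k] >].
have exrep : exists k, hasrep k.
  by have [w [aw ew]] := rep; exists (size w); apply/asboolP; exists w.
case: (ex_minnP exrep) => k /asboolP[w [aw ew sw]] min_k.
have min_w u : (letter_a, true) \notin u -> ev u = ev w -> (size w <= size u)%N.
  by move=> au eu; rewrite sw; apply: min_k; apply/asboolP; exists u; rewrite eu.
have shorten s u v : w = s ++ u ++ v -> ev u = 1%g -> (0 < size u)%N -> False.
  move=> wE eu u_gt0; have := min_w (s ++ v); move: aw.
  rewrite wE !evM eu mul1g !mem_cat !negb_or => /and3P[-> _ ->] /(_ isT erefl).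
  by rewrite !size_cat leq_add2l -{2}[size v]add0n leq_add2r leqNgt u_gt0.
exists w => //; split=> // i iw.
  apply: contrapT => run.
  apply: (@shorten (take i w) (nseq q x0) (drop (i + q) w)).
  - rewrite -{1}(cat_take_drop i w); congr (_ ++ _).
    rewrite -{1}(cat_take_drop q (drop i w)) drop_drop addnC; congr (_ ++ _).
    apply: (@eq_from_nth _ x0).
      rewrite size_nseq size_takel // size_drop.
      by rewrite leq_subRL ?(leq_trans _ iw) ?leq_addr // addnC.
    move=> h; rewrite size_takel ?size_drop; last first.
      by rewrite leq_subRL ?(leq_trans _ iw) ?leq_addr.
    move=> hq; rewrite nth_take // nth_drop nth_nseq hq; apply/eqP.
    apply: contraT => wh; case: run.
    by exists (i + h)%N; rewrite // leq_addr ltn_add2l.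
  - by rewrite ev_run.
  - by rewrite size_nseq.
apply/eqP => winv.
apply: (@shorten (take i w) [:: nth x0 w i; nth x0 w i.+1] (drop i.+2 w)) => //.
  by rewrite /= -!drop_nth ?cat_take_drop // ltnW.
rewrite winv; case: (nth x0 w i) => x b; rewrite /ev -pi1; congr (pi _).
by apply/pres_piP; apply: (@pres_eq_cancel _ _ [::] [::]).
Qed.

(** Modulo the normal closure of a^q, the element equals a reduced word of some
length L.  The representation attached to this word kills a^q, and it sends
the term L + 1 of the lower central series to 1, as the matrices have size
L + 1.  If L were positive, the upper right entry would be both 0 and 1. *)
Lemma gamma_omega_prime_power :
  gamma_omega G `<=` normal_closure [set (a ^+ q)%g].
Proof.
move=> g; set N := normal_closure _.
have normalN : is_normal_subgroup N by apply: normal_closure_normal.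
have [Q [pi [piM _ piK]]] := quotient_group normalN.
have [pi1 piV _ _ piX] := group_morphism piM.
have [|w red_w wE] := reduced_representative piM _ g.
  by rewrite -piX; apply/piK; apply: normal_closure_sub.
case: (posnP (size w)) => [/size0nil w0|w_gt0].
  by move=> _; apply/piK; rewrite -wE w0 BS_pi1.
move=> /gamma_omegaP/(_ (size w)) gg.
have [rho [rhoM rho1 rho_uni rhoq rhow]] := magnus_representation red_w.
have rhoV x : rho x^-1%g * rho x = 1 by rewrite -rhoM mulVg.
have kerN : N `<=` [set x | rho x = 1].
  apply: normal_closure_min => [|_ -> //]; split; first split=> //=.
  - by move=> x y ex ey; rewrite rhoM ex ey mulr1.
  - by move=> x ex; rewrite -(rhoV x) ex mulr1.
  - by move=> x y /= ex; rewrite conjgE !rhoM ex mul1r rhoV.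
have rhog : rho g = rho (pres_pi _ w).
  have : N ((pres_pi _ w)^-1 * g)%g.
    by apply/piK; rewrite piM piV wE mulVg.
  move=> /kerN /= e1.
  by rewrite -[g in LHS](mulVKg (pres_pi _ w)) rhoM e1 mulr1.
have : moves_forward (size w).+1 (rho g - 1).
  apply: (gamma_filtration rhoM rho1) gg => //.
  - by move=> c i j; rewrite mxE eqxx.
  - move=> c A B mA mB; apply: moves_forwardD => //.
    by move=> i j; rewrite mxE oppr_eq0 => /mB.
  - by move=> c A mA i j /mA; apply: leq_trans; rewrite leq_add2l.
  - by move=> c A B; rewrite -[c.+1]add1n; apply: moves_forwardM.
  - by move=> c A B; rewrite -[c.+1]addn1; apply: moves_forwardM.
move=> /(_ ord0 ord_max); rewrite rhog !mxE rhow.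
have -> : (ord0 == ord_max :> 'I_(size w).+1) = false.
  by apply/eqP => /(congr1 val) /= w0; rewrite -w0 in w_gt0.
by rewrite subr0 oner_eq0 => /(_ isT); rewrite add0n ltnn.
Qed.

End MagnusRepresentation.

(** * Gluing the primary parts *)

Section CoprimeParts.
Local Open Scope classical_set_scope.
Local Open Scope group_scope.
Variables (m n : int) (d : nat).
Hypotheses (d_gt0 : (0 < d)%N) (dm : (d%:Z %| m)%Z) (dn : (d%:Z %| n)%Z).
Local Notation G := (BS m n).
Local Notation a := (BS_a m n).
Local Notation t := (BS_t m n).

Definition BS_base : set G :=
  subgroup_generated [set a ^ expgz t k | k in setT].

Lemma generated_conj_invariant (Q : groupType) (h : G -> Q) (S : set Q) :
  {morph h : x y / x * y} ->
  (forall z s, z = h a \/ z = h t -> S s ->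
     subgroup_generated S (s ^ z) /\ subgroup_generated S (s ^ z^-1)) ->
  forall y x, subgroup_generated S x -> subgroup_generated S (x ^ h y).
Proof.
move=> hM Sz.
have [h1 hV _ _ _] := group_morphism hM.
have [B1 BM BV] : is_subgroup (subgroup_generated S).
  exact: subgroup_generated_subgroup.
have extend z : (forall s, S s -> subgroup_generated S (s ^ z)) ->
    forall x, subgroup_generated S x -> subgroup_generated S (x ^ z).
  move=> SzB; apply: (@subgroup_generated_min _ _
      (fun x => subgroup_generated S (x ^ z))) => //.
  split=> [|u v Bu Bv|u Bu]; rewrite ?conj1g ?conjMg ?conjVg //.
    exact: BM.
  exact: BV.
apply: BS_generated.
- by move=> x Bx; rewrite h1 conjg1.
- by move=> y z By Bz x Bx; rewrite hM conjgM; apply: Bz; apply: By.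
- by apply: extend => s Ss; have [] := Sz (h a) s (or_introl erefl) Ss.
- rewrite hV; apply: extend => s Ss.
  by have [] := Sz (h a) s (or_introl erefl) Ss.
- by apply: extend => s Ss; have [] := Sz (h t) s (or_intror erefl) Ss.
- rewrite hV; apply: extend => s Ss.
  by have [] := Sz (h t) s (or_intror erefl) Ss.
Qed.

Lemma BS_base_normal : is_normal_subgroup BS_base.
Proof.
have sgB : is_subgroup BS_base by apply: subgroup_generated_subgroup.
have [B1 BM BV] := sgB.
have Bgen k : BS_base (a ^ expgz t k).
  by apply: subgroup_generated_sub; exists k.
have Ba : BS_base a by have := Bgen 0%R; rewrite conjg1.
have conjB x y : BS_base x -> BS_base y -> BS_base (x ^ y).
  by move=> Bx By; rewrite conjgE; apply: (BM); [apply: BV|apply: (BM)].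
split=> // x y; move: y x; apply: (@generated_conj_invariant G id) => //.
move=> z _ [] -> [k _ <-]; first by split; apply: conjB => //; apply: BV.
rewrite -!conjgM; split.
  by have := Bgen (k + 1)%R; rewrite expgzD.
by have := Bgen (k - 1)%R; rewrite expgzB.
Qed.

(** Conjugation by a power of [tau] brings the second conjugate back to
[alpha]. *)
Lemma conj_powers_commute (Q : groupType) (alpha tau : Q) (e f : int)
    (mu nu : nat) :
  (forall k, commute ((alpha ^ expgz tau k) ^+ mu) (alpha ^+ nu)) ->
  (mu%:Z %| e)%Z -> (nu%:Z %| f)%Z ->
  forall k l,
    commute (expgz (alpha ^ expgz tau k) e) (expgz (alpha ^ expgz tau l) f).
Proof.
move=> com /dvdzP[e' ->] /dvdzP[f' ->] k l.
rewrite ![(_ * Posz _)%R]GRing.mulrC !expgzM; apply: commute_expgz2.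
have := com (k - l)%R => /(congr1 (conjg^~ (expgz tau l))).
by rewrite !conjMg !conjXg -conjgM -expgzD GRing.subrK.
Qed.

Definition power_closure (D : nat) : set G :=
  normal_closure ([set a ^+ D] `|` BS_commutators m n d).

(** Replacing a by its power a^e preserves the commutation relations, since
powers of commuting elements commute. *)
Lemma power_hom_kernel (Q : groupType) (h : G -> Q) (alpha tau : Q)
    (e : int) (D : nat) :
  {morph h : x y / x * y} -> h a = expgz alpha e -> h t = tau ->
  (forall k mu nu, coprime mu nu -> (mu * nu)%N = d ->
     commute ((alpha ^ expgz tau k) ^+ mu) (alpha ^+ nu)) ->
  expgz alpha (e * D%:Z)%R = 1 ->
  power_closure D `<=` [set x | h x = 1].
Proof.
move=> hM ha ht com aD.
have [h1 hV hJ hR hX] := group_morphism hM.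
apply: normal_closure_min.
  split; first split=> [//|x y /= hx hy|x /= hx].
  - by rewrite hM hx hy mulg1.
  - by rewrite hV hx invg1.
  by move=> x y /= hx; rewrite hJ hx conj1g.
move=> _ [->|[k [mu [nu [_ _ co dE ->]]]]] /=.
  by rewrite hX ha -[_ ^+ D]/(expgz _ D%:Z) -expgzM.
rewrite BS_commutatorE hR !hX hJ (morph_expgz hM) ha ht.
have swap x (j : nat) : expgz x e ^+ j = expgz (x ^+ j) e :> Q.
  exact: (expgzAC x e j).
apply/eqP/commgP; rewrite conjXz !swap.
by apply/commute_expgz2/com => //; apply/eqP.
Qed.

Lemma killed_commutators_commute (Q : groupType) (h : G -> Q) :
  {morph h : x y / x * y} -> BS_commutators m n d `<=` [set x | h x = 1] ->
  forall k mu nu, coprime mu nu -> (mu * nu)%N = d ->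
    commute ((h a ^ expgz (h t) k) ^+ mu) (h a ^+ nu).
Proof.
move=> hM kill k mu nu co dE; have [h1 hV hJ hR hX] := group_morphism hM.
apply/commgP/eqP; rewrite -(morph_expgz hM) -hJ -!hX -hR -BS_commutatorE.
apply: kill; exists k, mu, nu; split=> //; last exact/eqP.
  by move: d_gt0; rewrite -dE muln_gt0 => /andP[].
by move: d_gt0; rewrite -dE muln_gt0 => /andP[].
Qed.

(** Work modulo the normal closure of a^(D1 D2) and of the commutators.  Choose
e divisible by D1' and f divisible by D1 with e + f = 1.  As the image of a^d is
trivial, a -> a^e and a -> a^f (with t fixed) define homomorphisms phi and
psi.  The first kills a^D1 and the second kills a^D2, hence both kill g.  The
conjugates of a^D1' commute with those of a^D1, so phi and psi have commuting
values on the subgroup generated by the a_k; there the product of phi and psi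
is again a homomorphism, and it agrees with the projection on each
a_k = a_k^e a_k^f. *)
Lemma power_closure_combine (D1 D1' D2 : nat) (g : G) :
  (D1 * D1')%N = d -> coprime D1 D1' -> (D2 %| D1')%N ->
  power_closure D1 g -> power_closure D2 g -> power_closure (D1 * D2) g.
Proof.
move=> dE co D2D1' g1 g2.
have normalN : is_normal_subgroup (power_closure (D1 * D2)).
  exact: normal_closure_normal.
have [Q [pi [piM _ piK]]] := quotient_group normalN.
have [pi1 piV piJ piR piX] := group_morphism piM.
pose alpha := pi a; pose tau := pi t.
have aD : expgz alpha (D1 * D2)%:Z = 1.
  by rewrite /= -piX; apply/piK; apply: normal_closure_sub; left.
have com : forall k mu nu, coprime mu nu -> (mu * nu)%N = d ->
    commute ((alpha ^ expgz tau k) ^+ mu) (alpha ^+ nu).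
  apply: killed_commutators_commute => // x comm_x; apply/piK.
  by apply: normal_closure_sub; right.
have D12d : ((D1 * D2)%:Z %| d%:Z)%Z.
  by rewrite -dE; exact: (dvdn_mul (dvdnn D1) D2D1').
have rel e : tau^-1 * expgz (expgz alpha e) m * tau = expgz (expgz alpha e) n.
  have trivial k : (d%:Z %| k)%Z -> expgz (expgz alpha e) k = 1.
    move=> dk; rewrite expgzAC (expgz_dvd _ aD) ?expgz1 //.
    exact: dvdz_trans dk.
  by rewrite !trivial // mulg1 mulVg.
have /coprimezP[[v u] /= uv] : coprimez D1%:Z D1'%:Z by [].
pose e := (u * D1'%:Z)%R; pose f := (v * D1%:Z)%R.
have ef : (e + f)%R = 1%R by rewrite GRing.addrC.
have [phi [phiM phia phit]] := BS_hom (rel e).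
have [psi [psiM psia psit]] := BS_hom (rel f).
have phig : phi g = 1.
  apply: (power_hom_kernel phiM phia phit com) g1.
  apply: expgz_dvd aD; apply: (dvdz_trans D12d).
  by rewrite /e -dE PoszM GRing.mulrC GRing.mulrCA dvdz_mull.
have psig : psi g = 1.
  apply: (power_hom_kernel psiM psia psit com) g2.
  by apply: expgz_dvd aD; rewrite /f -GRing.mulrA -PoszM dvdz_mull.
have [phi1 phiV phiJ phiR phiX] := group_morphism phiM.
have [psi1 psiV psiJ psiR psiX] := group_morphism psiM.
have phi_gen k : phi (a ^ expgz t k) = expgz (alpha ^ expgz tau k) e.
  by rewrite phiJ (morph_expgz phiM) phia phit conjXz.
have psi_gen k : psi (a ^ expgz t k) = expgz (alpha ^ expgz tau k) f.
  by rewrite psiJ (morph_expgz psiM) psia psit conjXz.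
have com_gen k x : BS_base x -> commute (phi x) (psi (a ^ expgz t k)).
  move: x; apply: subgroup_generated_min => [|_ [l _ <-]].
    split=> [|x y cx cy|x cx]; apply: commute_sym.
    - by rewrite phi1; apply: commute1.
    - by rewrite phiM; apply: commuteM; apply: commute_sym.
    - by rewrite phiV; apply: commuteV; apply: commute_sym.
  rewrite phi_gen psi_gen.
  apply: (@conj_powers_commute _ alpha tau e f D1' D1).
  - by move=> j; apply: com; rewrite 1?coprime_sym // mulnC.
  - exact: dvdz_mull.
  - exact: dvdz_mull.
have com_base x y : BS_base x -> BS_base y -> commute (phi x) (psi y).
  move=> Bx; move: y; apply: subgroup_generated_min => [|_ [l _ <-]].
    split=> [|y z cy cz|y cy].
    - by rewrite psi1; apply: commute1.
    - by rewrite psiM; apply: commuteM.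
    - by rewrite psiV; apply: commuteV.
  exact: com_gen.
have [[B1 BM BV] BJ] := BS_base_normal.
have split_pi x : BS_base x -> BS_base x /\ pi x = phi x * psi x.
  move: x; apply: subgroup_generated_min => [|_ [l _ <-]].
    split=> [|x y [Bx ex] [By ey]|x [Bx ex]].
    - by rewrite pi1 phi1 psi1 mulg1.
    - split; first exact: BM.
      rewrite piM phiM psiM ex ey -!mulgA; congr (_ * _).
      rewrite !mulgA; congr (_ * _).
      by have /esym := com_base y x By Bx.
    - split; first exact: BV.
      rewrite piV phiV psiV ex invgM; apply: commute_sym.
      apply: commuteV; apply: commute_sym; apply: commuteV; apply: commute_sym.
      exact: com_base.
  split; first by apply: subgroup_generated_sub; exists l.
  by rewrite phi_gen psi_gen -expgzD ef piJ (morph_expgz piM).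
have Bg : BS_base g.
  move: g1; apply: normal_closure_min; first exact: BS_base_normal.
  have Ba : BS_base a.
    by apply: subgroup_generated_sub; exists 0%R; rewrite ?conjg1.
  have sgB : is_subgroup BS_base by [].
  move=> _ [->|[k [mu [nu [_ _ _ _ ->]]]]].
    exact: (subgroup_expgz D1%:Z sgB).
  rewrite BS_commutatorE commgEl; apply: BM.
    by apply: BV; apply: (subgroup_expgz mu%:Z sgB); exact: (BJ).
  by apply: (BJ); apply: (subgroup_expgz mu%:Z sgB); exact: (BJ).
by apply/piK; have [_ ->] := split_pi g Bg; rewrite phig psig mulg1.
Qed.

(** Induction on [D], splitting off the primary part of [D] for its least
prime.  The case [D = 1] is the prime power case with exponent 0. *)
Lemma gamma_omega_power_closure (D R : nat) (g : G) :
  (D * R)%N = d -> coprime D R -> gamma_omega G g -> power_closure D g.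
Proof.
elim/ltn_ind: D R => D IH R dE co gg.
have D_gt0 : (0 < D)%N by move: d_gt0; rewrite -dE muln_gt0 => /andP[].
have prime_power p e : prime p -> (p ^ e %| d)%N -> power_closure (p ^ e) g.
  move=> p_pr qd.
  have := gamma_omega_prime_power p_pr (dvdn_trans qd dm) (dvdn_trans qd dn) gg.
  apply: normal_closure_min; first exact: normal_closure_normal.
  by move=> x ->; apply: normal_closure_sub; left.
have [D1|D_neq1] := eqVneq D 1%N.
  by rewrite D1; apply: (prime_power 2%N 0%N); rewrite ?dvd1n.
pose p := pdiv D.
have p_pr : prime p.
  by apply: pdiv_prime; case: D D_gt0 D_neq1 {IH dE co} @p => [|[]].
pose q := (p ^ logn p D)%N.
have q_gt1 : (1 < q)%N.
  rewrite -(exp1n (logn p D)) ltn_exp2r ?prime_gt1 // logn_gt0.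
  by rewrite mem_primes p_pr D_gt0 pdiv_dvd.
have [D' co_p DE] := pfactor_coprime p_pr D_gt0.
have DE' : D = (q * D')%N by rewrite mulnC.
have D'_gt0 : (0 < D')%N by move: D_gt0; rewrite DE' muln_gt0 => /andP[].
have co_q : coprime q D' by apply: coprimeXl.
have [coqR coD'R] : coprime q R /\ coprime D' R.
  by move: co; rewrite DE' coprimeMl => /andP[].
rewrite DE'; apply: (@power_closure_combine q (D' * R)).
- by rewrite -dE DE' mulnA.
- by rewrite coprimeMr co_q coqR.
- exact: dvdn_mulr.
- apply: prime_power => //.
  by rewrite -dE [X in (_ %| X * _)%N]DE' -mulnA dvdn_mulr.
apply: (IH D' _ (q * R)%N) => //; first by rewrite DE' ltn_Pmull.
  by rewrite -dE DE' mulnA [(D' * q)%N]mulnC.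
by rewrite coprimeMr coprime_sym co_q coD'R.
Qed.

End CoprimeParts.

(** * Affine actions on Z/p^c *)

Section Triangular.
Import GRing.Theory.
Local Open Scope ring_scope.
Variable R : comNzRingType.
Implicit Types (x y z r : R) (A B : 'M[R]_2).

Definition tri x y z : 'M[R]_2 :=
  \matrix_(i, j) if i == ord0 then (if j == ord0 then x else y)
                 else (if j == ord0 then 0 else z).

Lemma mulmx2E A B i j :
  (A * B) i j = A i ord0 * B ord0 j + A i ord_max * B ord_max j.
Proof.
rewrite mxE big_ord_recl big_ord1.
by have -> : lift ord0 ord0 = ord_max :> 'I_2 by apply: val_inj.
Qed.

Lemma tri_mul x y z x' y' z' :
  tri x y z * tri x' y' z' = tri (x * x') (x * y' + y * z') (z * z').
Proof.
apply/matrixP => i j; rewrite mulmx2E !mxE /=.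
by case: (i == ord0); case: (j == ord0);
  rewrite ?(mulr0, mul0r, addr0, add0r).
Qed.

Lemma tri1 : tri 1 0 1 = 1.
Proof.
apply/matrixP => i j; rewrite !mxE.
by case: i j => [[|[|i]] Hi] [[|[|j]] Hj].
Qed.

Lemma tri_unipotentX y k : tri 1 y 1 ^+ k = tri 1 (y *+ k) 1.
Proof.
elim: k => [|k IH]; first by rewrite expr0 mulr0n tri1.
by rewrite exprS IH tri_mul !mul1r mulr1 addrC -mulrS.
Qed.

Lemma tri_sub1 x y z : tri x y z - 1 = tri (x - 1) y (z - 1).
Proof.
rewrite -tri1; apply/matrixP => i j; rewrite !mxE.
by case: (i == ord0); case: (j == ord0); rewrite ?subr0.
Qed.

Variable p : R.

(** The corner entry lags one power of [p] behind the diagonal.  The filtration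
stays multiplicative, and it contains [tri 1 1 1 - 1] in degree 1. *)
Definition tri_filter k A := exists x y z : R,
  A = tri (p ^+ k * x) (p ^+ k.-1 * y) (p ^+ k * z).

Lemma tri_filter0 k : tri_filter k 0.
Proof.
exists 0, 0, 0; rewrite !mulr0; apply/matrixP => i j.
by rewrite !mxE; do 2 case: ifP.
Qed.

Lemma tri_filterB k A B :
  tri_filter k A -> tri_filter k B -> tri_filter k (A - B).
Proof.
move=> [x [y [z ->]]] [x' [y' [z' ->]]].
exists (x - x'), (y - y'), (z - z'); rewrite !mulrBr.
apply/matrixP => i j; rewrite !mxE.
by case: (i == ord0); case: (j == ord0); rewrite ?subr0.
Qed.

Lemma tri_filterW k A : tri_filter k.+1 A -> tri_filter k A.
Proof.
move=> [x [y [z ->]]]; exists (p * x), (p ^+ (k - k.-1) * y), (p * z).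
by rewrite !mulrA -!exprSr -exprD subnKC // leq_pred.
Qed.

Lemma tri_filterMl k A B :
  tri_filter 1 A -> tri_filter k B -> tri_filter k.+1 (A * B).
Proof.
move=> [x [y [z ->]]] [x' [y' [z' ->]]]; rewrite tri_mul expr1 expr0 mul1r.
(* The exponent k.-1.+1 - k is 1 if k = 0, where k.-1 = k, and 0 otherwise. *)
exists (x * x'), (p ^+ (k.-1.+1 - k) * (x * y') + y * z'), (z * z').
rewrite mulrACA -exprS (mulrACA p z) -exprS; congr (tri _ _ _).
rewrite mulrDr /= (mulrCA y); congr (_ + _).
by rewrite mulrACA -exprS [RHS]mulrA -exprD subnKC ?leqSpred.
Qed.

Lemma tri_filterMr k A B :
  tri_filter k A -> tri_filter 1 B -> tri_filter k.+1 (A * B).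
Proof.
move=> [x [y [z ->]]] [x' [y' [z' ->]]]; rewrite tri_mul expr1 expr0 mul1r.
exists (x * x'), (x * y' + p ^+ (k.-1.+1 - k) * (y * z')), (z * z').
rewrite mulrACA -exprSr (mulrACA _ z) -exprSr; congr (tri _ _ _).
rewrite mulrDr -[in LHS]mulrA; congr (_ + _).
by rewrite mulrACA -exprSr [RHS]mulrA -exprD subnKC ?leqSpred.
Qed.

End Triangular.

Section PowersOfA.
Import GRing.Theory.
Local Open Scope ring_scope.
Variables (m n m1 n1 : int) (d p : nat).
Hypotheses (p_pr : prime p) (co : coprimez m1 n1).
Hypotheses (mE : m = d%:Z * m1) (nE : n = d%:Z * n1).
Hypothesis (mod_p : (n1 = m1 %[mod p%:Z])%Z).
Local Notation G := (BS m n).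

Lemma prime_coprime_m1 : coprimez m1 p%:Z /\ coprimez n1 p%:Z.
Proof.
have eq_dvd : (p%:Z %| m1)%Z = (p%:Z %| n1)%Z.
  by apply/dvdz_mod0P/dvdz_mod0P; rewrite mod_p.
have nm1 : ~~ (p%:Z %| m1)%Z.
  apply/negP => pm1; have pn1 : (p%:Z %| n1)%Z by rewrite -eq_dvd.
  have : (p%:Z %| gcdz m1 n1)%Z by rewrite dvdz_gcd pm1.
  rewrite (eqP co) dvdz1 /= => /eqP p1.
  by move: p_pr; rewrite p1.
have nn1 : ~~ (p%:Z %| n1)%Z by rewrite -eq_dvd.
by split; rewrite coprimez_sym coprimezE prime_coprime.
Qed.

(** The matrices are those of the affine maps: a is the translation by 1 and t
the multiplication by u n1, which stands for n1 / m1 and is congruent to 1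
modulo p. *)
Lemma affine_representation (R : comNzRingType) (u v : R) :
  u * m1%:~R = 1 -> v * n1%:~R = 1 ->
  exists rho : G -> 'M[R]_2,
    [/\ {morph rho : x y / (x * y)%g >-> x * y}, rho 1%g = 1,
        forall j, rho (BS_a m n ^+ j)%g = tri 1 j%:R 1 &
        forall g, tri_filter p%:R 1 (rho g - 1)].
Proof.
move=> um vn.
pose be := u * n1%:~R; pose be' := v * m1%:~R.
have bb : be * be' = 1.
  by rewrite /be /be' mulrACA [_ * m1%:~R]mulrC mulrACA um vn mulr1.
have b'b : be' * be = 1 by rewrite mulrC.
have AA' : tri 1 1 1 * tri 1 (-1) 1 = 1 :> 'M[R]_2.
  by rewrite tri_mul !mul1r addNr tri1.
have A'A : tri 1 (-1) 1 * tri 1 1 1 = 1 :> 'M[R]_2.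
  by rewrite tri_mul !mul1r mulr1 addrN tri1.
have UU' : tri 1 0 be * tri 1 0 be' = 1.
  by rewrite tri_mul !mul1r mul0r addr0 bb tri1.
have U'U : tri 1 0 be' * tri 1 0 be = 1.
  by rewrite tri_mul !mul1r mul0r addr0 b'b tri1.
have expA k :
    iter `|k| ( *%R (if (k < 0)%R then tri 1 (-1) 1 else tri 1 1 1)) 1 =
    tri 1 k%:~R 1 :> 'M[R]_2.
  rewrite iter_mulr_1; case: k => k; first by rewrite tri_unipotentX.
  by rewrite tri_unipotentX NegzE mulrNz mulNrn.
have [|rho [rhoM rho1 [rhoa rhoaV] [rhot rhotV]]] := @BS_universal m n _ 1
    *%R (tri 1 1 1) (tri 1 (-1) 1) (tri 1 0 be) (tri 1 0 be') AA' A'A UU' U'U.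
  rewrite /= !expA !tri_mul !mul1r !mul0r add0r addr0 b'b; congr (tri _ _ _).
  by rewrite mE nE !intrM -mulrA; congr (_ * _); rewrite mulrCA mulrA um mul1r.
exists rho; split=> // [j|].
  rewrite -tri_unipotentX -rhoa.
  by elim: j => [|j IH]; rewrite ?expr0 // expgS rhoM IH exprS.
have [s sE] : exists s, n1 = m1 + s * p%:Z.
  have /dvdzP[s sE] : (p%:Z %| n1 - m1)%Z by rewrite -eqz_mod_dvd; apply/eqP.
  by exists s; rewrite -sE addrC subrK.
have filter1 (x z : R) : tri_filter p%:R 1 (tri 1 x (1 + p%:R * z) - 1).
  exists 0, x, z; rewrite tri_sub1 expr1 expr0 mul1r mulr0 subrr.
  by rewrite [1 + _]addrC addrK.
have filterM (x y : 'M[R]_2) :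
    tri_filter p%:R 1 (x - 1) -> tri_filter p%:R 1 (y - 1) ->
    tri_filter p%:R 1 (x * y - 1).
  move=> fx fy.
  have -> : x * y - 1 = (x - 1) * (y - 1) - (0 - (y - 1)) - (0 - (x - 1)).
    by rewrite !sub0r !opprK mulrBl mul1r subrK mulrBr mulr1 addrA subrK.
  have f0 := tri_filter0 (p%:R : R) 1.
  apply: (tri_filterB (tri_filterB _ (tri_filterB f0 fy)) (tri_filterB f0 fx)).
  by apply: tri_filterW; apply: tri_filterMl.
apply: BS_generated => [|x y|||| ].
- by rewrite rho1 subrr; apply: tri_filter0.
- by rewrite rhoM; apply: filterM.
- by rewrite rhoa; have := filter1 1 0; rewrite mulr0 addr0.
- by rewrite rhoaV; have := filter1 (-1) 0; rewrite mulr0 addr0.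
- rewrite rhot; have := filter1 0 (u * s%:~R).
  suff <- : be = 1 + p%:R * (u * s%:~R) by [].
  rewrite /be sE intrD intrM mulrDr um; congr (_ + _).
  by rewrite [in LHS]mulrA [RHS]mulrC.
- rewrite rhotV; have := filter1 0 (- (v * s%:~R)).
  suff <- : be' = 1 + p%:R * - (v * s%:~R) by [].
  have -> : be' = v * (n1 - s * p%:Z)%:~R by rewrite sE addrK.
  rewrite intrB intrM mulrBr vn mulrN; congr (_ - _).
  by rewrite [in LHS]mulrA [RHS]mulrC.
Qed.

(** The affine representation modulo N = p^(j+1) kills the corner entries of
the term j + 2 of the lower central series, so N divides j; but j < N. *)
Lemma gamma_omega_power_trivial j : gamma_omega G (BS_a m n ^+ j)%g -> j = 0%N.
Proof.
move=> /gamma_omegaP/(_ j.+1) gj.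
have [com con] := prime_coprime_m1.
pose N := (p ^ j.+1)%N.
have N_gt1 : (1 < N)%N by rewrite -(exp1n j.+1) ltn_exp2r ?prime_gt1.
have jN : (j < N)%N by apply: ltnW; apply: ltn_expl; apply: prime_gt1.
have N0 : N%:R = 0 :> 'Z_N by apply: pchar_Zp.
have inv k : coprimez k p%:Z -> exists u : 'Z_N, u * k%:~R = 1.
  move=> cok; have : coprimez k N%:Z.
    by rewrite coprimezE coprimeXr.
  case/coprimezP=> -[u v] /= uv; exists u%:~R.
  rewrite -intrM -[RHS]/(1%:~R) -uv intrD !intrM.
  by rewrite -[N%:Z%:~R]/(N%:R) N0 mulr0 addr0.
have [u um] := inv _ com; have [v vn] := inv _ con.
have [rho [rhoM rho1 rhoa rhoJ]] := affine_representation um vn.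
have := gamma_filtration rhoM rho1 (tri_filter0 p%:R) (@tri_filterB _ p%:R)
  (@tri_filterW _ p%:R) (@tri_filterMl _ p%:R) (@tri_filterMr _ p%:R) rhoJ gj.
case=> [x [y [z]]]; rewrite rhoa tri_sub1 => /matrixP/(_ ord0 ord_max).
rewrite !mxE /= -natrX N0 mul0r.
by move/(congr1 val) => /=; rewrite val_Zp_nat // modn_small.
Qed.

End PowersOfA.

(** * Locally cyclic groups of rational type *)

Section RationalChain.
Local Open Scope classical_set_scope.
Local Open Scope group_scope.
Variables (Q : groupType) (x : int -> Q) (m1 n1 : int).
Hypotheses (com : forall k l, commute (x k) (x l)) (co : coprimez m1 n1).
Hypothesis step : forall k, expgz (x (k + 1)%R) m1 = expgz (x k) n1.

(** Suppose that x_s, ..., x_(s+J) are powers of y, with x_(s+J) = y^(n1^J), and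
let X = x_(s+J+1).  Then X^m1 = y^(n1^(J+1)) with coprime exponents, so y and X
are the powers of y^u X^v with exponents m1 and n1^(J+1), where
u m1 + v n1^(J+1) = 1. *)
Lemma rational_chain_cyclic (s : int) (J : nat) :
  exists z, (forall k, commute z (x k)) /\
    forall i, (i <= J)%N ->
      x (s + Posz i)%R = expgz z (m1 ^+ (J - i) * n1 ^+ i)%R.
Proof.
elim: J => [|J [y [cy yE]]].
  exists (x s); split=> // i; rewrite leqn0 => /eqP ->.
  by rewrite GRing.addr0 !GRing.expr0 GRing.mul1r.
pose X := x (s + Posz J.+1)%R.
have XE : expgz X m1 = expgz y (n1 ^+ J.+1)%R.
  rewrite /X -addn1 PoszD GRing.addrA step yE // subnn GRing.expr0 GRing.mul1r.
  by rewrite -expgzM addn1 GRing.exprSr.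
have /coprimezP[[u v] /= uv] : coprimez m1 (n1 ^+ J.+1)%R by apply: coprimezXr.
have cyX : commute (expgz y u) (expgz X v) by apply/commute_expgz2/cy.
have zm1 : expgz (expgz y u * expgz X v) m1 = y.
  rewrite expgMz // (expgzAC X) XE -!expgzM -expgzD (GRing.mulrC _ v) uv.
  exact: expg1.
have zn1 : expgz (expgz y u * expgz X v) (n1 ^+ J.+1)%R = X.
  rewrite expgMz // (expgzAC y) -XE -!expgzM -expgzD (GRing.mulrC m1) uv.
  exact: expg1.
exists (expgz y u * expgz X v); split.
  move=> k; apply: commute_sym; apply: commuteM; apply: commute_sym.
    by apply: commute_expgz; apply: cy.
  by apply: commute_expgz; apply: com.
move=> i; rewrite leq_eqVlt => /predU1P[->|].
  by rewrite subnn GRing.expr0 GRing.mul1r zn1.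
rewrite ltnS => iJ; rewrite subSn // GRing.exprS -GRing.mulrA expgzM zm1.
exact: yE.
Qed.

(** The property that survives products is to be a power of any z of which all
the [x k] with [k] in a large enough interval are powers. *)
Lemma rational_chain_locally_cyclic h :
  subgroup_generated [set x k | k in setT] h ->
  exists z (s r : int) (J : nat), x s = expgz z (m1 ^+ J)%R /\ h = expgz z r.
Proof.
pose in_cycle (z y : Q) := exists r : int, y = expgz z r.
suff gen : subgroup_generated [set x k | k in setT] `<=`
    [set h | exists B : nat, forall z,
       (forall k : int, (`|k| <= B)%N -> in_cycle z (x k)) -> in_cycle z h].
  move=> /gen[B cycB].
  have [z [_ zE]] := rational_chain_cyclic (- Posz B)%R (B + B).
  have [|r hE] := cycB z.
    move=> k kB.
    have [i iB ->] : exists2 i : nat, (i <= B + B)%N &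
        k = (- Posz B + Posz i)%R.
      by exists `|(k + Posz B)%R|%N; lia.
    by exists (m1 ^+ (B + B - i) * n1 ^+ i)%R; apply: zE.
  exists z, (- Posz B)%R, r, (B + B)%N; split=> //.
  have := zE 0%N (leq0n _).
  by rewrite GRing.addr0 subn0 GRing.expr0 GRing.mulr1.
apply: subgroup_generated_min.
  split=> [|g h' [B cg] [B' ch]|g [B cg]].
  - by exists 0%N => z _; exists 0%R.
  - exists (maxn B B') => z zB.
    have [|r ->] := cg z.
      by move=> k kB; apply: zB; rewrite leq_max kB.
    have [|r' ->] := ch z.
      by move=> k kB; apply: zB; rewrite leq_max kB orbT.
    by exists (r + r')%R; rewrite expgzD.
  - exists B => z /cg[r ->]; exists (- r)%R; by rewrite expgzN.
by move=> _ [k _ <-]; exists `|k|%N => z; apply.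
Qed.

End RationalChain.

(** * The case of a prime dividing n1 - m1 *)

Section CentralPowers.
Local Open Scope classical_set_scope.
Local Open Scope group_scope.
Variables (m n m1 n1 : int) (d p : nat).
Hypotheses (d_gt0 : (0 < d)%N) (p_pr : prime p) (co : coprimez m1 n1).
Hypotheses (mE : m = (d%:Z * m1)%R) (nE : n = (d%:Z * n1)%R).
Hypothesis (mod_p : (n1 = m1 %[mod p%:Z])%Z).
Local Notation G := (BS m n).
Local Notation a := (BS_a m n).
Local Notation t := (BS_t m n).

(** Modulo N, the element g is a power z^r of a root z of some a_s^d, say
z^M = a_s^d.  So g^M is conjugate to a^(d r) modulo N, which is contained in
gamma_omega; hence a^(d r) lies in gamma_omega and r = 0. *)
Lemma power_closure_gamma_omega g :
  power_closure d d g -> gamma_omega G g ->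
  normal_closure (BS_commutators m n d) g.
Proof.
set N := normal_closure _ => pg gg.
have normalN : is_normal_subgroup N by apply: normal_closure_normal.
have [Q [pi [piM _ piK]]] := quotient_group normalN.
have [pi1 piV piJ piR piX] := group_morphism piM.
pose alpha := pi a; pose tau := pi t.
pose x k := expgz (alpha ^ expgz tau k) d%:Z.
have piE k : pi (a ^ expgz t k) = alpha ^ expgz tau k.
  by rewrite piJ (morph_expgz piM).
have x_central k l : commute (x k) (alpha ^ expgz tau l).
  apply: (@conj_powers_commute _ alpha tau d%:Z 1%R d 1%N) => // {}k.
  apply: (killed_commutators_commute d_gt0 piM); rewrite ?coprimen1 ?muln1 //.
  by move=> y comm_y; apply/piK; apply: normal_closure_sub.
have x_com k l : commute (x k) (x l).
  apply: commute_sym; apply: commute_expgz; apply: commute_sym.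
  exact: x_central.
have x_step k : expgz (x (k + 1)%R) m1 = expgz (x k) n1.
  rewrite /x -!expgzM -mE -nE; apply: conj_relation.
  by rewrite -!(morph_expgz piM) -piV -!piM BS_relation.
pose A := subgroup_generated [set x k | k in setT].
have sgA : is_subgroup A by apply: subgroup_generated_subgroup.
have [A1 AM AV] := sgA.
have Ax k : A (x k) by apply: subgroup_generated_sub; exists k.
have AJ y h : A h -> A (h ^ pi y).
  move: y h; apply: generated_conj_invariant => // z _ [] -> [k _ <-].
    have := x_central k 0%R; rewrite conjg1 => cxa.
    have fix_x y : commute (x k) y -> x k ^ y = x k.
      by move=> cxz; apply/conjg_fixP/commgP.
    by split; rewrite fix_x //; [exact: Ax|exact: Ax|exact: commuteV].
  rewrite /x !conjXz -!conjgM; split.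
    by have := Ax (k + 1)%R; rewrite /x expgzD.
  by have := Ax (k - 1)%R; rewrite /x expgzB.
have Ag : A (pi g).
  move: g pg {gg}; apply: normal_closure_min.
    split; first split=> [|u v Au Av|u Au]; rewrite /= ?pi1 ?piM ?piV //.
    - exact: AM.
    - exact: AV.
    by move=> u v Au; rewrite /= piJ; apply: AJ.
  move=> u [->|comm_u]; last first.
    by rewrite /= (proj2 (piK u)) //; apply: normal_closure_sub.
  by rewrite /= piX; have := Ax 0%R; rewrite /x conjg1.
have [z [s [r [J [xE gE]]]]] :=
  rational_chain_locally_cyclic x_com co x_step Ag.
have sgO : is_normal_subgroup (gamma_omega G) by apply: gamma_omega_normal.
have [sgO' OJ] := sgO; have [O1 OM OV] := sgO'.
have NO : N `<=` gamma_omega G.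
  by apply: normal_closure_min => //; apply: BS_commutators_gamma_omega mE nE.
pose b := expgz a (d%:Z * r)%R.
have Ob : gamma_omega G b.
  have OMgJ := subgroup_expgz (m1 ^+ J)%R sgO' gg.
  have Nq : N ((expgz g (m1 ^+ J)%R)^-1 * (b ^ expgz t s)).
    apply/piK; rewrite piM piV (morph_expgz piM) gE.
    rewrite conjXz (morph_expgz piM) piE expgzM -/(x s) xE.
    by rewrite (expgzAC z) mulVg.
  have := OM _ _ OMgJ (NO _ Nq); rewrite mulVKg => Obt.
  by rewrite -(conjgK (expgz t s) b); apply: OJ.
have Oabs : gamma_omega G (a ^+ `|(d%:Z * r)%R|).
  move: Ob; rewrite /b; case: (d%:Z * r)%R => k //= Obk.
  by rewrite -[_ ^+ _]invgK; apply: OV.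
have := gamma_omega_power_trivial p_pr co mE nE mod_p Oabs.
move/eqP; rewrite abszM muln_eq0 absz_nat eqn0Ngt d_gt0 /= absz_eq0 => /eqP r0.
by apply/piK; rewrite gE r0.
Qed.

End CentralPowers.

Local Open Scope classical_set_scope.

Theorem theorem1 (m n : int) (d : nat) (m1 n1 : int)
  (hm0 : m <> 0%R) (hn0 : n <> 0%R)
  (hm : (0 < m)%R) (hmn : (m <= `|n|)%R)
  (hd : Posz d = gcdz m n)
  (hm1 : m = (Posz d * m1)%R) (hn1 : n = (Posz d * n1)%R) :
  ((forall p : nat, prime p -> (n1 <> m1 %[mod Posz p])%Z) ->
    gamma_omega (BS m n) =
      normal_closure ([set (BS_a m n ^+ d)%g] `|` BS_commutators m n d))
  /\
  ((exists2 p : nat, prime p & (n1 = m1 %[mod Posz p])%Z) ->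
    gamma_omega (BS m n) = normal_closure (BS_commutators m n d)).
Proof.
have d_gt0 : (0 < d)%N.
  rewrite lt0n; apply: contra_notN hm0 => /eqP d0.
  by rewrite hm1 d0 GRing.mul0r.
have co : coprimez m1 n1.
  have : d = (d * gcdn `|m1| `|n1|)%N.
    have [] : Posz d = Posz (gcdn `|m| `|n|) by rewrite hd.
    by rewrite hm1 hn1 !abszM absz_nat muln_gcdr.
  rewrite coprimezE /coprime -{1}[d]muln1 => /eqP.
  by rewrite eqn_pmul2l // eq_sym.
have dm : (Posz d %| m)%Z by rewrite hm1 dvdz_mulr.
have dn : (Posz d %| n)%Z by rewrite hn1 dvdz_mulr.
have commO := BS_commutators_gamma_omega co hm1 hn1.
have upper (g : BS m n) : gamma_omega (BS m n) g -> power_closure d d g.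
  by apply: (gamma_omega_power_closure d_gt0 dm dn (muln1 d)); apply: coprimen1.
have normalO := gamma_omega_normal (BS m n).
split=> [nomod|[p p_pr mod_p]]; apply/seteqP; split=> g.
- exact: upper.
- apply: normal_closure_min => // x [->|]; last exact: commO.
  exact: BS_power_gamma_omega hm1 hn1 nomod.
- move=> gg; apply: (power_closure_gamma_omega d_gt0 p_pr co hm1 hn1 mod_p) => //.
  exact: upper.
- exact: normal_closure_min.
Qed.
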